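(* Let $K$ be an infinite field, and let $f\in K[X,Y,Z]$ be a polynomial of degree $2$ or $3$; let $\mathcal{X}:=V(f)\subset\mathbb{A}^3_K$. Suppose that: (1) $\mathcal{X}_\infty$ is irreducible; (2) $\mathcal{X}_\infty$ contains nonsingular points of $\overline{\mathcal{X}}$; (3) $\mathcal{X}_\infty$ does not contain any $K$-rational point. Then $\dim\mathcal{R}(K[\mathcal{X}])=2$.
   Context: For an integral domain $D$ with quotient field $Q(D)$, the reciprocal complement $\mathcal{R}(D)$ is the subring of $Q(D)$ generated by all $1/x$ with $x\in D\setminus\{0\}$; $\dim$ denotes Krull dimension. $K$ is not assumed algebraically closed. The points of $\mathbb{A}^n_K$ are the $n$-tuples in $\overline{K}^n$ ($\overline K$ an algebraic closure of $K$) up to the action of the $K$-automorphisms of $\overline{K}$ (equivalently, maximal ideals of $K[X_1,\ldots,X_n]$); similarly, the points of $\mathbb{P}^n_K$ are points $[a_0:\cdots:a_n]$ with coordinates in $\overline{K}$ (up to scaling), up to $K$-automorphisms of $\overline{K}$. $\mathbb{A}^n_K$ is identified with the subset $x_0\neq 0$ of $\mathbb{P}^n_K$. $V(f)$ is the affine variety defined by $f$, $K[\mathcal{X}]=K[X,Y,Z]/(f)$ is its coordinate ring (all rings considered are integral domains), $\overline{\mathcal{X}}$ is the projective closure of $\mathcal{X}$ in $\mathbb{P}^3_K$, and $\mathcal{X}_\infty:=\overline{\mathcal{X}}\setminus\mathcal{X}$. *)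

(* Defs.v *)
From HB Require Import structures.
From mathcomp Require Import all_boot all_order all_algebra.
From mathcomp Require Import boolp classical_sets cardinality.
From mathcomp Require Import mpoly.

Set Implicit Arguments.
Unset Strict Implicit.
Unset Printing Implicit Defensive.

Import GRing.Theory.
Local Open Scope ring_scope.
Local Open Scope quotient_scope.

Section CommutativeAlgebra.
Variable R : comNzRingType.

Definition lin_span n (x : 'I_n -> R) (y : R) : Prop :=
  exists c : 'I_n -> R, y = \sum_i c i * x i.

(* The structures [idealr] and [prime_idealr] are proper ideals. *)
Definition prime_chain n (P : 'I_n.+1 -> prime_idealr R) : Prop :=
  forall i j : 'I_n.+1, (i < j)%N ->
    {subset P i <= P j} /\ exists2 y, y \in P j & y \notin P i.

Definition has_krull_dim (d : nat) : Prop :=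
  (exists P : 'I_d.+1 -> prime_idealr R, prime_chain P) /\
  (forall n (P : 'I_n.+1 -> prime_idealr R), prime_chain P -> (n <= d)%N).

Definition noetherian : Prop :=
  forall I : idealr R, exists n (x : 'I_n -> R),
    forall y, y \in I <-> lin_span x y.

Definition local_with (m : idealr R) : Prop :=
  forall y, y \notin m -> exists z, y * z = 1.

(* A Noetherian local ring of dimension d whose maximal ideal is generated by
   d elements. *)
Definition regular_local_ring : Prop :=
  noetherian /\
  exists m : idealr R, local_with m /\
  exists d, has_krull_dim d /\
  exists x : 'I_d -> R, forall y, y \in m <-> lin_span x y.

End CommutativeAlgebra.

Section DomainQuotient.
Variables (R : comNzRingType) (I : prime_idealr R).

Definition domain_quot : Type := {ideal_quot I}.
HB.instance Definition _ := GRing.ComNzRing.on domain_quot.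

Definition quot_class (x : R) : domain_quot := \pi_{ideal_quot I} x.

Lemma quot_class_zmod : zmod_morphism quot_class.
Proof. exact: (raddfB \pi_{ideal_quot I}). Qed.

Lemma quot_class_monoid : monoid_morphism quot_class.
Proof. by split; [exact: rmorph1 | exact: rmorphM]. Qed.

HB.instance Definition _ := GRing.isZmodMorphism.Build R domain_quot quot_class
  quot_class_zmod.
HB.instance Definition _ := GRing.isMonoidMorphism.Build R domain_quot
  quot_class quot_class_monoid.

Definition quot_unit : {pred domain_quot} :=
  [pred x | `[< exists y, y * x = 1 >]].

Definition quot_inv (x : domain_quot) : domain_quot :=
  if pselect (exists y, y * x = 1) is left h then projT1 (cid h) else x.

Lemma quot_mulVx : {in quot_unit, left_inverse 1 quot_inv *%R}.
Proof.
move=> x /asboolP h; rewrite /quot_inv; case: pselect => // h'.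
exact: (projT2 (cid h')).
Qed.

Lemma quot_unitPl (x y : domain_quot) : y * x = 1 -> quot_unit x.
Proof. by move=> h; apply/asboolP; exists y. Qed.

Lemma quot_inv_out : {in [predC quot_unit], quot_inv =1 id}.
Proof.
by move=> x /asboolP h; rewrite /quot_inv; case: pselect.
Qed.

HB.instance Definition _ := GRing.ComNzRing_hasMulInverse.Build domain_quot
  quot_mulVx quot_unitPl quot_inv_out.

Lemma quot_mulf_eq0 (x y : domain_quot) : x * y = 0 -> (x == 0) || (y == 0).
Proof. exact: Quotient.rquot_IdomainAxiom. Qed.

HB.instance Definition _ := GRing.ComUnitRing_isIntegral.Build domain_quot
  quot_mulf_eq0.

End DomainQuotient.

Section PrincipalIdeal.
Variables (R : comNzRingType) (f : R).

Definition principal : {pred R} := [pred g | `[< exists h, g = h * f >]].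

Definition principal_is_prime : Prop :=
  idealr_closed principal /\ prime_idealr_closed principal.

Definition principal_prime (fP : principal_is_prime) : {pred R} := principal.

HB.instance Definition _ fP :=
  isIdealr.Build R (principal_prime fP) (proj1 fP).
HB.instance Definition _ fP :=
  isPrimeIdealrClosed.Build R (principal_prime fP) (proj2 fP).

End PrincipalIdeal.

Section ReciprocalComplement.
Variable D : idomainType.

(* The smallest subring containing the inverses of the nonzero elements of D. *)
Definition in_recip_compl : {pred {fraction D}} :=
  [pred y | `[< forall S : GRing.SubringClosed.type {fraction D},
                  (forall x : D, x != 0 -> (tofrac x)^-1 \in S) -> y \in S >]].

Lemma in_recip_compl_subring : GRing.subring_closed in_recip_compl.
Proof.
split=> [|x y /asboolP hx /asboolP hy|x y /asboolP hx /asboolP hy];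
  apply/asboolP => S hS.
- exact: rpred1.
- by apply: rpredB; [exact: hx | exact: hy].
- by apply: rpredM; [exact: hx | exact: hy].
Qed.

HB.instance Definition _ :=
  GRing.isSubringClosed.Build {fraction D} in_recip_compl
    in_recip_compl_subring.

Record recip_compl := RecipCompl {
  recip_compl_val :> {fraction D};
  _ : recip_compl_val \in in_recip_compl }.

HB.instance Definition _ := [isSub for recip_compl_val].
HB.instance Definition _ := [Choice of recip_compl by <:].
HB.instance Definition _ := [SubChoice_isSubComNzRing of recip_compl by <:].

End ReciprocalComplement.

Definition is_algebraic_closure (K : fieldType) (L : closedFieldType)
    (iota : {rmorphism K -> L}) : Prop :=
  forall z : L, algebraicOver iota z.

Section Geometry.
Variables (K : fieldType) (L : closedFieldType) (iota : {rmorphism K -> L}).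
Variable n : nat.

(* Points are handled through representing tuples in the algebraic closure;
   [same_point] is equality of the points represented.  Zero loci of
   polynomials over K, hence all sets of points below, are stable under it. *)

Record hcoords := HCoords {
  hcoord :> 'I_n.+1 -> L;
  hcoords_neq0 : exists i, hcoord i != 0 }.

Definition same_point (P Q : hcoords) : Prop :=
  exists sigma : {rmorphism L -> L},
    [/\ bijective sigma, (forall a, sigma (iota a) = iota a) &
        exists2 c : L, c != 0 & forall i, Q i = c * sigma (P i)].

Definition with_one (R : nzRingType) (a : 'I_n -> R) : 'I_n.+1 -> R :=
  fun i => if unlift ord0 i is Some j then a j else 1.

Lemma with_one_neq0 (a : 'I_n -> L) : exists i, with_one a i != 0.
Proof. by exists ord0; rewrite /with_one unlift_none oner_neq0. Qed.

Definition affine_point (a : 'I_n -> L) : hcoords :=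
  HCoords (with_one_neq0 a).

Definition eval_at m (g : {mpoly K[m]}) (v : 'I_m -> L) : L :=
  (map_mpoly iota g).@[v].

Definition affine_locus (f : {mpoly K[n]}) : set ('I_n -> L) :=
  [set a | eval_at f a = 0].

Definition in_projective (X : set ('I_n -> L)) : set hcoords :=
  [set P | exists2 a, X a & same_point (affine_point a) P].

Definition proj_locus (S : set {mpoly K[n.+1]}) : set hcoords :=
  [set P | forall g, S g -> eval_at g P = 0].

Definition zariski_closed (C : set hcoords) : Prop :=
  exists S : set {mpoly K[n.+1]},
    (forall g, S g -> exists d, g \is d.-homog) /\ C = proj_locus S.

Definition projective_closure (X : set ('I_n -> L)) : set hcoords :=
  [set P | forall C, zariski_closed C -> (in_projective X `<=` C)%classic ->
             C P].

Definition at_infinity (X : set ('I_n -> L)) : set hcoords :=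
  (projective_closure X `\` in_projective X)%classic.

Definition irreducible_set (Z : set hcoords) : Prop :=
  (Z !=set0)%classic /\
  forall C1 C2, zariski_closed C1 -> zariski_closed C2 ->
    (Z `<=` C1 `|` C2)%classic -> (Z `<=` C1)%classic \/ (Z `<=` C2)%classic.

Definition K_rational (P : hcoords) : Prop :=
  exists Q : hcoords, (forall i, exists b : K, Q i = iota b) /\ same_point Q P.

Definition dehomogenize (g : {mpoly K[n.+1]}) : {mpoly K[n]} :=
  g \mPo [tuple with_one (fun j => 'X_j) i | i < n.+1].

Section AffineHypersurface.
Variables (f : {mpoly K[n]}) (fP : principal_is_prime f).

Definition coord_ring : idomainType := domain_quot (principal_prime fP).

Definition restrict (g : {mpoly K[n.+1]}) : {fraction coord_ring} :=
  tofrac (quot_class (principal_prime fP) (dehomogenize g) : coord_ring).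

(* Rational functions on the projective closure of V(f), whose function field
   is that of V(f), that are quotients of forms of the same degree with
   denominator nonzero at P.  When P lies on the projective closure,
   [restrict h != 0] follows from [eval_at h P != 0]. *)
Definition in_local_ring (P : hcoords) : {pred {fraction coord_ring}} :=
  [pred y | `[< exists d (g h : {mpoly K[n.+1]}),
                  [/\ g \is d.-homog, h \is d.-homog, eval_at h P != 0,
                      restrict h != 0 & y = restrict g / restrict h] >]].

Lemma restrictB g h : restrict (g - h) = restrict g - restrict h.
Proof. by rewrite /restrict /dehomogenize !rmorphB. Qed.

Lemma restrictM g h : restrict (g * h) = restrict g * restrict h.
Proof. by rewrite /restrict /dehomogenize !rmorphM. Qed.

Lemma restrict1 : restrict 1 = 1.
Proof. by rewrite /restrict /dehomogenize !rmorph1. Qed.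

Lemma in_local_ring_subring P : GRing.subring_closed (in_local_ring P).
Proof.
split.
- apply/asboolP; exists 0%N, 1, 1; split; rewrite ?dhomog1 //.
  + by rewrite /eval_at !rmorph1 oner_neq0.
  + by rewrite restrict1 oner_neq0.
  + by rewrite restrict1 divr1.
- move=> x y /asboolP [d [g [h [gd hd hP h0 ->]]]].
  move=> /asboolP [e [g' [h' [ge he hP' h0' ->]]]].
  apply/asboolP; exists (d + e)%N, (g * h' - g' * h), (h * h'); split.
  + by apply: rpredB; [|rewrite mulrC]; exact: dhomogM.
  + exact: dhomogM.
  + rewrite /eval_at !rmorphM; exact: (mulf_neq0 hP hP').
  + rewrite restrictM; exact: (mulf_neq0 h0 h0').
  + rewrite (restrictB (g * h') (g' * h)) !restrictM -mulNr.
    rewrite (addf_div _ _ h0 h0') mulNr; reflexivity.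
- move=> x y /asboolP [d [g [h [gd hd hP h0 ->]]]].
  move=> /asboolP [e [g' [h' [ge he hP' h0' ->]]]].
  apply/asboolP; exists (d + e)%N, (g * g'), (h * h'); split.
  + exact: dhomogM.
  + exact: dhomogM.
  + rewrite /eval_at !rmorphM; exact: (mulf_neq0 hP hP').
  + rewrite restrictM; exact: (mulf_neq0 h0 h0').
  + rewrite !restrictM mulf_div; reflexivity.
Qed.

HB.instance Definition _ P :=
  GRing.isSubringClosed.Build {fraction coord_ring} (in_local_ring P)
    (in_local_ring_subring P).

Record local_ring (P : hcoords) := LocalRing {
  local_ring_val :> {fraction coord_ring};
  _ : local_ring_val \in in_local_ring P }.

HB.instance Definition _ P := [isSub for @local_ring_val P].
HB.instance Definition _ P := [Choice of local_ring P by <:].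
HB.instance Definition _ P := [SubChoice_isSubComNzRing of local_ring P by <:].

(* Over a field that need not be perfect, nonsingular means that the local
   ring is regular, which is weaker than the Jacobian criterion. *)
Definition nonsingular_point (P : hcoords) : Prop :=
  projective_closure (affine_locus f) P /\ regular_local_ring (local_ring P).

End AffineHypersurface.
End Geometry.

(* Main.v *)
Require Import Defs.
From HB Require Import structures.
From mathcomp Require Import all_boot all_order all_algebra.
From mathcomp Require Import boolp classical_sets cardinality.
From mathcomp Require Import mpoly ring.

Set Implicit Arguments.
Unset Strict Implicit.
Unset Printing Implicit Defensive.

Import GRing.Theory.
Local Open Scope ring_scope.

(** Let [D] be the coordinate ring of the surface [f = 0], and let [F] be the
    form of highest degree of [f], so that the points at infinity of the
    surface are the zeros of [F].

    Upper bound.  The ring [R(D)] contains [K] and lies in the quotient field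
    of [D], in which any three elements are algebraically dependent over [K]:
    there are about [N^3] monomials of degree at most [N] in three elements,
    but modulo [f] the polynomials of degree at most [C N] span a space of
    dimension only [O(N^2)] ([recip_compl_relation]).  Along a chain of four
    primes, elements chosen in the successive differences would be
    algebraically independent ([prime_chain_le2]).

    Lower bound.  A valuation of the quotient field of [D] that is nonpositive
    on the nonzero elements of [D] is nonnegative on all the generators [1/x]
    of [R(D)], hence has a center on [R(D)], which is a prime ideal.  Coarsening
    the valuation shrinks the center, so that a valuation of rank two yields a
    chain [0 < P1 < P2] as soon as the two centers are nonzero and distinct
    ([two_step_chain]).

    The valuation comes from the projection of the surface to the [X]-axis.
    Its generic fiber is a plane curve over [K(X)] whose points at infinity
    are the zeros of the binary form [F(0,Y,Z)].  If this form is irreducible,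
    then the fiber has exactly one place at infinity; being the only pole of
    the functions in [D], it takes nonpositive values on the nonzero ones.
    This is the coarse valuation, the opposite of the degree in [Y] and [Z].
    Refining it by the degree in [X] of the leading coefficient gives the
    valuation of rank two; [1/Y] lies in the smaller center, and [1/X] lies in
    the larger one only ([surface_chain]).

    Irreducibility.  A binary form of degree two or three over [K] is
    irreducible as soon as it has no nontrivial zero in [K]
    ([irreducible_edge_poly]).  A nontrivial zero of [F] in [K] would be a
    [K]-rational point at infinity; that it belongs to the projective closure
    ([top_form_zero_at_infinity]) rests on the fact that a polynomial vanishing
    on the hypersurface [f = 0] is a multiple of [f] ([nullstellensatz]). *)

(** * Coefficients and degrees of polynomials *)

Lemma coefM_top (R : nzRingType) (P Q : {poly R}) r q :
  (size P <= r.+1)%N -> (size Q <= q.+1)%N -> (P * Q)`_(r + q) = P`_r * Q`_q.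
Proof.
move=> sP sQ; rewrite coefM.
have ltr : (r < (r + q).+1)%N by rewrite ltnS leq_addr.
rewrite (bigD1 (Ordinal ltr)) //= addKn big1 ?addr0 // => i.
rewrite -val_eqE /= neq_ltn => /orP [lt_ir|lt_ri].
  rewrite [Q`__]nth_default ?mulr0 // (leq_trans sQ) //.
  by rewrite ltn_subRL ltn_add2r.
by rewrite [P`__]nth_default ?mul0r // (leq_trans sP).
Qed.

Lemma coef_neq0_size (R : nzRingType) (p : {poly R}) i :
  p`_i != 0 -> (i < size p)%N.
Proof. by apply: contraNT; rewrite -leqNgt => /(nth_default 0) ->. Qed.

Definition mnm3 (a b c : nat) : 'X_{1..3} :=
  [multinom nth 0%N [:: a; b; c] i | i < 3].

Lemma mnm3P (m : 'X_{1..3}) a b c :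
  (m == mnm3 a b c) = [&& m 0%R == a, m 1%R == b & m 2%:R == c].
Proof.
apply/eqP/and3P => [->|[/eqP <- /eqP <- /eqP <-]]; first by rewrite !mnmE.
by apply/mnmP => -[[|[|[|//]]] hi]; rewrite mnmE /=; congr (m _); apply: val_inj.
Qed.

Lemma mdeg3 (m : 'X_{1..3}) : mdeg m = (m 0%R + m 1%R + m 2%:R)%N.
Proof.
rewrite mdegE 3!big_ord_recl big_ord0 addn0 addnA.
by congr (_ + _ + _)%N; congr (m _); apply: val_inj.
Qed.

Lemma mpoly_rmorph_eq n (R : comNzRingType) (S : comNzRingType)
    (phi psi : {rmorphism {mpoly R[n]} -> S}) :
    (forall c, phi c%:MP = psi c%:MP) -> (forall i, phi 'X_i = psi 'X_i) ->
  phi =1 psi.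
Proof.
move=> eC eX p; rewrite (mpolyE p) !rmorph_sum; apply: eq_bigr => m _.
rewrite -mul_mpolyC !rmorphM eC mpolyXE_id !rmorph_prod; congr (_ * _).
by apply: eq_bigr => i _; rewrite !rmorphXn eX.
Qed.

Section MultivariateSize.
Variable K : fieldType.

Lemma msizeM_le n (p q : {mpoly K[n]}) a b : (msize p <= a.+1)%N ->
  (msize q <= b.+1)%N -> (msize (p * q) <= (a + b).+1)%N.
Proof.
have [->|p0] := eqVneq p 0; first by rewrite mul0r msize0.
have [->|q0] := eqVneq q 0; first by rewrite mulr0 msize0.
move=> pa qb; rewrite msizeM // -subn1 leq_subLR add1n.
by apply: leq_trans (leq_add pa qb) _; rewrite addSn addnS.
Qed.

Lemma msizeX_le n (p : {mpoly K[n]}) a k : (msize p <= a.+1)%N ->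
  (msize (p ^+ k) <= (k * a).+1)%N.
Proof.
move=> pa; elim: k => [|k IHk]; first by rewrite expr0 msize1.
by rewrite exprS mulSn; apply: msizeM_le.
Qed.

End MultivariateSize.

(** * Primes of the reciprocal complement cut out by valuations *)

Section DegreePreorder.
Variable D : idomainType.

Lemma fraction_repr (y : {fraction D}) :
  exists a b : D, b != 0 /\ y = tofrac a / tofrac b.
Proof.
elim/quotW: y => r; exists (frac r).1, (frac r).2; split; first exact: denom_ratioP.
set n := (frac r).1; set d := (frac r).2.
have d0 : d != 0 by apply: denom_ratioP.
unlock tofrac.
rewrite -[X in _ = _ * X]FracField.pi_inv -[RHS]FracField.pi_mul.
rewrite /FracField.mulf /FracField.invf /= !numden_Ratio ?oner_neq0 //.
by rewrite mulr1 mul1r /n /d Ratio_numden.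
Qed.

(** A preorder of this kind compares the values of a valuation: [le a b] means
    that the value of [a] is at least that of [b], as for degrees.  Encoding a
    valuation by the comparison that it induces on [D] avoids value groups, so
    that the valuations of rank one and of rank two are treated alike.  The
    last two fields say that the valuation is nonpositive on the nonzero
    elements of [D], and that the value of [0] is larger than that of [1]. *)
Record degree_preorder (le : D -> D -> Prop) : Prop := DegreePreorder {
  le_total : forall a b, le a b \/ le b a;
  le_trans : forall b a c, le a b -> le b c -> le a c;
  le_sub : forall a b c, le a c -> le b c -> le (a - b) c;
  le_mul : forall a b c, c != 0 -> (le (a * c) (b * c) <-> le a b);
  le_one : forall a, a != 0 -> le 1 a;
  le_one0 : ~ le 1 0 }.

Variable le : D -> D -> Prop.
Hypothesis leP : degree_preorder le.

Lemma le_zero a : le 0 a.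
Proof.
have laa : le a a by case: (le_total leP a a).
by rewrite -(subrr a); apply: (le_sub leP).
Qed.

Let le_add a b c : le a c -> le b c -> le (a + b) c.
Proof.
move=> ac bc; rewrite -[b]opprK; apply: (le_sub leP) => //.
by rewrite -sub0r; apply: (le_sub leP) => //; apply: le_zero.
Qed.

Let lt_add a b c : ~ le c a -> ~ le c b -> ~ le c (a + b).
Proof.
move=> ca cb cab; case: (le_total leP a b) => h.
  apply: cb; apply: (le_trans leP cab); apply: le_add => //.
  by case: (le_total leP b b).
apply: ca; apply: (le_trans leP cab); apply: le_add => //.
by case: (le_total leP a a).
Qed.

(** The comparison of a numerator with its denominator depends on the fraction
    only, which makes the valuation ring and its maximal ideal meaningful. *)
Lemma ge_frac (a b c d : D) : b != 0 -> d != 0 ->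
  tofrac a / tofrac b = tofrac c / tofrac d -> le b a -> le d c.
Proof.
move=> b0 d0 /eqP; rewrite eqr_div ?tofrac_eq0 // -!tofracM tofrac_eq.
move=> /eqP e ab; apply/(le_mul leP _ _ b0); rewrite -e.
by rewrite [d * b]mulrC; apply/(le_mul leP _ _ d0).
Qed.

Definition valuation_ring : {pred {fraction D}} :=
  [pred y | `[< exists a b, [/\ b != 0, y = tofrac a / tofrac b & le a b] >]].

Lemma valuation_ring_subring : GRing.subring_closed valuation_ring.
Proof.
split.
- apply/asboolP; exists 1, 1; rewrite oner_neq0 divff ?tofrac_eq0 ?oner_neq0 //.
  by split=> //; case: (le_total leP 1 1).
- move=> x y /asboolP [a [b [b0 -> ab]]] /asboolP [c [d [d0 -> cd]]].
  apply/asboolP; exists (a * d - c * b), (b * d); split.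
  + exact: mulf_neq0.
  + rewrite -mulNr addf_div ?tofrac_eq0 // tofracB !tofracM mulNr; reflexivity.
  + apply: (le_sub leP); first exact/(le_mul leP).
    by rewrite [b * d]mulrC; apply/(le_mul leP).
- move=> x y /asboolP [a [b [b0 -> ab]]] /asboolP [c [d [d0 -> cd]]].
  apply/asboolP; exists (a * c), (b * d); split.
  + exact: mulf_neq0.
  + rewrite mulf_div !tofracM; reflexivity.
  + apply: (le_trans leP (b := b * c)).
      have [->|c0] := eqVneq c 0; last exact/(le_mul leP).
      by rewrite !mulr0; apply: le_zero.
    by rewrite ![b * _]mulrC; apply/(le_mul leP).
Qed.

HB.instance Definition _ := GRing.isSubringClosed.Build {fraction D}
  valuation_ring valuation_ring_subring.

(** The generators [1/x] of the reciprocal complement are in the valuation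
    ring because [le 1 x]. *)
Lemma recip_compl_valuation_ring (y : recip_compl D) :
  val y \in valuation_ring.
Proof.
case: y => y /= /asboolP; apply => x x0; apply/asboolP.
exists 1, x; split=> //; first by rewrite tofrac1 div1r.
exact: (le_one leP).
Qed.

(** The contraction to [R(D)] of the maximal ideal of the valuation ring.  The
    preorder axioms appear as an argument so that the ideal structures below
    can be attached to it. *)
Definition center (_ : degree_preorder le) : {pred recip_compl D} :=
  [pred y | `[< exists a b, [/\ b != 0, val y = tofrac a / tofrac b
                              & ~ le b a] >]].

Lemma center_idealr_closed : idealr_closed (center leP).
Proof.
split.
- apply/asboolP; exists 0, 1; rewrite oner_neq0 tofrac0 mul0r rmorph0.
  split=> //; exact: (le_one0 leP).
- apply/asboolP => -[a [b [b0 e]]]; apply.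
  apply: (ge_frac (a := 1) (b := 1) _ b0) => //.
  + exact: oner_neq0.
  + by rewrite tofrac1 divr1 -e rmorph1.
  + by case: (le_total leP 1 1).
- move=> u x y /asboolP [a [b [b0 ex ab]]] /asboolP [c [d [d0 ey cd]]].
  have /asboolP [k [l [l0 eu kl]]] := recip_compl_valuation_ring u.
  apply/asboolP; exists (k * a * d + c * (l * b)), (l * b * d).
  have lb0 : l * b != 0 by apply: mulf_neq0.
  split.
  + exact: mulf_neq0.
  + have -> : val (u * x + y) = val u * val x + val y by [].
    rewrite ex ey eu mulf_div -!tofracM.
    rewrite addf_div ?tofrac_eq0 // -!tofracM -tofracD; reflexivity.
  + apply: lt_add.
      move=> /(le_mul leP _ _ d0) h; apply: ab.
      have k0 : k != 0.
        apply/eqP => k0; move: h; rewrite k0 mul0r.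
        move/(le_trans leP (le_one leP lb0)); exact: (le_one0 leP).
      apply/(le_mul leP b a k0); rewrite ![_ * k]mulrC.
      apply: (le_trans leP _ h); exact/(le_mul leP k l b0).
    by rewrite [l * b * d]mulrC => /(le_mul leP _ _ lb0).
Qed.

Lemma center_prime_closed : prime_idealr_closed (center leP).
Proof.
move=> x y; have [a [b [b0 ex]]] := fraction_repr (val x).
have [c [d [d0 ey]]] := fraction_repr (val y).
move=> /asboolP [k [l [l0 e kl]]].
case: (pselect (le b a)) => ba; last first.
  by apply/orP; left; apply/asboolP; exists a, b.
case: (pselect (le d c)) => dc; last first.
  by apply/orP; right; apply/asboolP; exists c, d.
case: kl; apply: (ge_frac (a := a * c) (b := b * d)) => //.
- exact: mulf_neq0.
- have <- : val x * val y = tofrac k / tofrac l by rewrite -e.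
  rewrite ex ey mulf_div !tofracM; reflexivity.
- have c0 : c != 0.
    apply/eqP => c0; move: dc; rewrite c0.
    move/(le_trans leP (le_one leP d0)); exact: (le_one0 leP).
  apply: (le_trans leP (b := b * c)); last exact/(le_mul leP).
  by rewrite ![b * _]mulrC; apply/(le_mul leP).
Qed.

HB.instance Definition _ :=
  isIdealr.Build (recip_compl D) (center leP) center_idealr_closed.
HB.instance Definition _ :=
  isPrimeIdealrClosed.Build (recip_compl D) (center leP) center_prime_closed.

End DegreePreorder.

Section Reciprocal.
Variable D : idomainType.

Fact reciprocal_subproof (x : D) : (tofrac x)^-1 \in @in_recip_compl D.
Proof.
apply/asboolP => S hS; have [->|x0] := eqVneq x 0; last exact: hS.
by rewrite tofrac0 invr0 rpred0.
Qed.

Definition reciprocal (x : D) : recip_compl D :=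
  RecipCompl (reciprocal_subproof x).

Lemma reciprocal_center le (leP : degree_preorder le) (x : D) : x != 0 ->
  (reciprocal x \in center leP) <-> ~ le x 1.
Proof.
move=> x0; split.
- move=> /asboolP [a [b [b0 e ab]]] x1; apply: ab.
  apply: (ge_frac leP (a := 1) (b := x)) => //.
  by rewrite tofrac1 div1r -e.
- move=> x1; apply/asboolP; exists 1, x; split=> //.
  by rewrite tofrac1 div1r.
Qed.

Definition zero_ideal : {pred recip_compl D} := pred1 0.

Lemma zero_idealr_closed : idealr_closed zero_ideal.
Proof.
split; rewrite ?inE ?oner_neq0 ?eqxx // => a x y.
by rewrite !inE => /eqP -> /eqP ->; rewrite mulr0 addr0.
Qed.

Lemma zero_prime_closed : prime_idealr_closed zero_ideal.
Proof.
by move=> x y; rewrite !inE -!val_eqE /= mulf_eq0.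
Qed.

HB.instance Definition _ :=
  isIdealr.Build (recip_compl D) zero_ideal zero_idealr_closed.
HB.instance Definition _ :=
  isPrimeIdealrClosed.Build (recip_compl D) zero_ideal zero_prime_closed.

(** The preorder [le1] is a coarsening of [le2]; the element [x] is a unit for
    the coarse valuation but not for the fine one, and this separates the two
    centers. *)
Lemma two_step_chain (le1 le2 : D -> D -> Prop)
    (le1P : degree_preorder le1) (le2P : degree_preorder le2) (x y : D) :
    (forall a b, le2 a b -> le1 a b) ->
    le1 x 1 -> ~ le2 x 1 -> ~ le1 y 1 ->
  exists P : 'I_3 -> prime_idealr (recip_compl D), prime_chain P.
Proof.
move=> le21 x1 x2 y1.
have x0 : x != 0.
  by apply/eqP => x0; apply: x2; rewrite x0; apply: (le_zero le2P).
have y0 : y != 0.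
  by apply/eqP => y0; apply: y1; rewrite y0; apply: (le_zero le1P).
pose P (i : 'I_3) : prime_idealr (recip_compl D) :=
  nth (zero_ideal : prime_idealr _)
    [:: (zero_ideal : prime_idealr _); (center le1P : prime_idealr _);
        (center le2P : prime_idealr _)] i.
have P01 : {subset zero_ideal <= center le1P}.
  move=> z; rewrite inE => /eqP ->; exact: (idealr0 (center le1P)).
have P12 : {subset center le1P <= center le2P}.
  move=> z /asboolP [a [b [b0 e ab]]]; apply/asboolP; exists a, b.
  by split=> // /le21.
have nz (z : D) : z != 0 -> reciprocal z \notin zero_ideal.
  by move=> z0; rewrite inE -val_eqE /= invr_eq0 tofrac_eq0.
have yP1 : reciprocal y \in center le1P by apply/reciprocal_center.
have xP2 : reciprocal x \in center le2P by apply/reciprocal_center.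
have xP1 : reciprocal x \notin center le1P.
  by apply/negP => /(reciprocal_center le1P x0); apply.
exists P => -[[|[|[|//]]] hi] [[|[|[|//]]] hj] //= _; rewrite /P /=; split=> //.
- by exists (reciprocal y) => //; apply: nz.
- by move=> z /P01 /P12.
- by exists (reciprocal x) => //; apply: nz.
- by exists (reciprocal x).
Qed.

End Reciprocal.

(** * Chains of primes and algebraic independence *)

Section ChainBound.
Variables (R : comNzRingType) (K : fieldType) (kappa : {rmorphism K -> R}).

(** Think of [Z i] as: the coefficient [u i] vanishes identically.  Dividing
    the relation by the largest power of [y] that it contains, which is allowed
    since [y] is not in [P], shows that the lowest remaining coefficient lies
    in [Q]. *)
Lemma lowest_coefficients_vanish (P Q : prime_idealr R) (y : R) N
    (u : 'I_N -> R) (Z : 'I_N -> Prop) :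
    {subset P <= Q} -> y \in Q -> y \notin P ->
    (forall i, Z i -> u i = 0) -> (forall i, u i \in Q -> Z i) ->
  \sum_i u i * y ^+ i \in P -> forall i, Z i.
Proof.
move=> PQ yQ yP Z0 QZ sP i0; have [n le_n] := ubnP (i0 : nat).
elim: n i0 le_n => // n IHn i0; rewrite ltnS => le_n.
have yX k : y ^+ k \notin P.
  elim: k => [|k IHk]; first by rewrite expr0 idealr1.
  by rewrite exprS prime_idealrM negb_or yP.
apply: QZ; set r := \sum_(i < N | (i0 < i)%N) u i * y ^+ (i - i0.+1).
have e : \sum_i u i * y ^+ i = y ^+ i0 * (u i0 + y * r).
  rewrite (bigD1 i0) //= mulrDr mulrC; congr (_ + _).
  rewrite (bigID (fun i : 'I_N => (i0 < i)%N)) /= [X in _ + X]big1 ?addr0.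
    rewrite /r !mulr_sumr; apply: eq_big => [i|i /andP [_ lti]].
      by rewrite -val_eqE /= andb_idl // => /gtn_eqF ->.
    by rewrite mulrA -exprSr mulrCA -exprD subnKC.
  move=> i /andP [ne]; rewrite -leqNgt leq_eqVlt val_eqE (negPf ne) /= => lti.
  by rewrite Z0 ?mul0r //; apply: IHn; apply: leq_trans le_n.
have /PQ h : u i0 + y * r \in P.
  by move: sP; rewrite e prime_idealrM (negPf (yX _)).
by rewrite -(addrK (y * r) (u i0)) rpredB // mulrC idealMr.
Qed.

Definition satisfies_relation (y1 y2 y3 : R) : Prop :=
  exists N (c : 'I_N -> 'I_N -> 'I_N -> K),
    (exists i j k, c i j k != 0) /\
    \sum_i (\sum_j (\sum_k kappa (c i j k) * y3 ^+ k) * y2 ^+ j) * y1 ^+ i = 0.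

(** A relation between elements chosen in the successive differences of the
    chain is nested: its coefficients are polynomials in the next elements.
    Going up the chain reduces its vanishing to that of constants that lie in a
    prime ideal, and these are zero. *)
Lemma prime_chain_le2 :
  (forall y1 y2 y3, satisfies_relation y1 y2 y3) ->
  forall n (P : 'I_n.+1 -> prime_idealr R), prime_chain P -> (n <= 2)%N.
Proof.
move=> rel n P chainP; rewrite leqNgt; apply/negP => n3.
pose o k : 'I_n.+1 := inord k.
have step k : (k < 3)%N -> {subset P (o k) <= P (o k.+1)} /\
    exists2 y, y \in P (o k.+1) & y \notin P (o k).
  move=> k3; have kn : (k < n)%N := leq_trans k3 n3.
  by apply: chainP; rewrite !inordK ?ltnS // ltnW.
have [P01 [y1 y1P y1N]] := step 0 isT.
have [P12 [y2 y2P y2N]] := step 1 isT.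
have [P23 [y3 y3P y3N]] := step 2 isT.
have [N [c [[i [j [k]]]]]] := rel y1 y2 y3.
move=> /eqP cN0 e; apply: cN0; move: i j k.
have kappa_inj (P' : prime_idealr R) a : kappa a \in P' -> a = 0.
  move=> aP; apply/eqP/negP => /negP a0; have := idealr1 P'.
  by rewrite -(rmorph1 kappa) -(mulVf a0) rmorphM idealMr.
apply: (@lowest_coefficients_vanish (P (o 0)) (P (o 1)) y1 N
  (fun i => \sum_j (\sum_k kappa (c i j k) * y3 ^+ k) * y2 ^+ j)
  (fun i => forall j k, c i j k = 0)) => //; last by rewrite e rpred0.
- move=> i ci; rewrite big1 // => j _; rewrite big1 ?mul0r // => k _.
  by rewrite ci rmorph0 mul0r.
- move=> i; apply: (@lowest_coefficients_vanish _ (P (o 2)) y2 N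
    (fun j => \sum_k kappa (c i j k) * y3 ^+ k)
    (fun j => forall k, c i j k = 0)) => //.
  + by move=> j cj; rewrite big1 // => k _; rewrite cj rmorph0 mul0r.
  + move=> j; apply: (@lowest_coefficients_vanish _ (P (o 3)) y3 N
      (fun k => kappa (c i j k)) (fun k => c i j k = 0)) => //.
    * by move=> k ->; rewrite rmorph0.
    * by move=> k; apply: kappa_inj.
Qed.

End ChainBound.

(** * Three elements of the function field of a surface are dependent *)

Section LinearRelations.
Variable K : fieldType.

Lemma matrix_relation (I J : finType) (A : I -> J -> K) : (#|J| < #|I|)%N ->
  exists c : I -> K, (exists i, c i != 0) /\ forall j, \sum_i c i * A i j = 0.
Proof.
move=> ltJI; pose M := \matrix_(i < #|I|, j < #|J|) A (enum_val i) (enum_val j).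
have : kermx M != 0.
  rewrite kermx_eq0 -row_leq_rank -ltnNge; apply: leq_ltn_trans ltJI.
  exact: rank_leq_col.
case/rowV0Pn => v /sub_kermxP vM /rV0Pn [i0 vi0].
exists (fun i => v ord0 (enum_rank i)); split.
  by exists (enum_val i0); rewrite enum_valK.
move=> j; have := congr1 (fun w : 'rV_#|J| => w ord0 (enum_rank j)) vM.
rewrite !mxE => vMj; rewrite -[RHS]vMj (reindex (@enum_val I predT)) /=.
  by apply: eq_bigr => i _; rewrite mxE enum_valK enum_rankK.
by apply: onW_bij; apply: enum_val_bij.
Qed.

Lemma mpoly_relation n (I : finType) (p : I -> {mpoly K[n]}) B :
    (forall i, (msize (p i) <= B)%N) -> (#|{: 'X_{1..n < B}}| < #|I|)%N ->
  exists c : I -> K, (exists i, c i != 0) /\ \sum_i c i *: p i = 0.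
Proof.
move=> pB /(matrix_relation (fun i (m : 'X_{1..n < B}) => (p i)@_m)).
case=> c [c0 rel]; exists c; split=> //; apply/mpolyP => m.
rewrite mcoeff0 raddf_sum /=; case: (ltnP (mdeg m) B) => mB.
  rewrite -[RHS](rel (BMultinom mB)); apply: eq_bigr => i _; exact: mcoeffZ.
rewrite big1 // => i _; rewrite mcoeffZ memN_msupp_eq0 ?mulr0 //.
by apply: msize_mdeg_ge; apply: leq_trans (pB i) mB.
Qed.

(** A monomial of degree at least [b] in three variables is determined by its
    degree and two of its exponents, which bounds their number by a quantity
    that is only quadratic in the degree. *)
Lemma card_monomials_shift b d :
  (#|{: 'X_{1..3 < b + d}}| <= #|{: 'X_{1..3 < b}}| + d * (b + d) ^ 2)%N.
Proof.
pose s1 := [seq (m : 'X_{1..3}) | m : 'X_{1..3 < b + d}].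
pose s2 := [seq (m : 'X_{1..3}) | m : 'X_{1..3 < b}] ++
  [seq mnm3 ac.1 ac.2 (e - ac.1 - ac.2) | e <- iota b d,
     ac <- [seq (a, c) | a <- iota 0 (b + d), c <- iota 0 (b + d)]].
have -> : #|{: 'X_{1..3 < b + d}}| = size s1 by rewrite size_map cardE.
have -> : (#|{: 'X_{1..3 < b}}| + d * (b + d) ^ 2)%N = size s2.
  by rewrite size_cat size_map -cardE !size_allpairs !size_iota mulnn.
apply: uniq_leq_size; first by rewrite map_inj_uniq ?enum_uniq //; apply: val_inj.
move=> _ /mapP [m _ ->]; rewrite mem_cat.
case: (ltnP (mdeg m) b) => mb.
  by apply/orP; left; apply/mapP; exists (BMultinom mb); rewrite ?mem_enum.
apply/orP; right; have := bmdeg m => mbd.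
have e := mdeg3 m.
apply/allpairsP; exists (mdeg m, (m 0%R, m 1%R)); split=> /=.
- by rewrite mem_iota mb mbd.
- apply/allpairsP; exists (m 0%R, m 1%R); split=> //=; rewrite mem_iota /= add0n.
    by apply: leq_ltn_trans mbd; rewrite e -addnA leq_addr.
  by apply: leq_ltn_trans mbd; rewrite e addnAC leq_addl.
- by apply/eqP; rewrite mnm3P /= e -addnA addKn addKn !eqxx.
Qed.

End LinearRelations.

Section Hypersurface.
Variables (K : fieldType) (n : nat) (f : {mpoly K[n]}).
Variable fP : principal_is_prime f.

Definition residue (p : {mpoly K[n]}) : coord_ring fP :=
  quot_class (principal_prime fP) p.

HB.instance Definition _ := GRing.RMorphism.copy residue
  (quot_class (principal_prime fP)).

Lemma residue_surj (x : coord_ring fP) : exists p, residue p = x.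
Proof. exists (repr (x : {ideal_quot (principal_prime fP)})); exact: reprK. Qed.

Lemma residue_eq0 p : residue p = 0 <-> exists h, p = h * f.
Proof.
have e : (residue p == 0) = (p \in principal_prime fP).
  have -> : (0 : coord_ring fP) = residue 0 by rewrite rmorph0.
  by rewrite -[in RHS](subr0 p) Quotient.idealrBE.
by split=> [/eqP|h]; [rewrite e => /asboolP | apply/eqP; rewrite e; apply/asboolP].
Qed.

End Hypersurface.

Section Constants.
Variables (K : fieldType) (D : idomainType) (phi : {rmorphism K -> D}).

(** A nonzero constant is the reciprocal of another one. *)
Fact const_recip_subproof (c : K) :
  tofrac (phi c) \in @in_recip_compl D.
Proof.
have [->|c0] := eqVneq c 0; first by rewrite !rmorph0 rpred0.
have -> : tofrac (phi c) = (tofrac (phi c^-1))^-1.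
  by rewrite -[RHS](fmorphV (@tofrac D \o phi)) /= invrK.
exact: reciprocal_subproof.
Qed.

Definition const_recip (c : K) : recip_compl D :=
  RecipCompl (const_recip_subproof c).

Lemma const_recip_zmod : zmod_morphism const_recip.
Proof. by move=> a b; apply: val_inj; rewrite /= !rmorphB. Qed.

Lemma const_recip_monoid : monoid_morphism const_recip.
Proof.
by split=> [|a b]; apply: val_inj; rewrite /= ?rmorph1 ?rmorphM.
Qed.

HB.instance Definition _ := GRing.isZmodMorphism.Build K
  (recip_compl D) const_recip const_recip_zmod.
HB.instance Definition _ := GRing.isMonoidMorphism.Build K
  (recip_compl D) const_recip const_recip_monoid.

End Constants.

Lemma clear_denominator (F : fieldType) (a b c d : F) :
  b != 0 -> a / b * (b * c * d) = a * c * d.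
Proof. by move=> b0; rewrite !mulrA divfK. Qed.

Lemma dehomogenized_relation (F : fieldType) N
    (c : 'I_N -> 'I_N -> 'I_N -> F) (y1 y2 y3 b a1 a2 a3 : F) :
    b != 0 -> y1 * b = a1 -> y2 * b = a2 -> y3 * b = a3 ->
    \sum_i \sum_j \sum_k
      c i j k * (a1 ^+ i * a2 ^+ j * a3 ^+ k * b ^+ (3 * N - (i + j + k))) = 0 ->
  \sum_i (\sum_j (\sum_k c i j k * y3 ^+ k) * y2 ^+ j) * y1 ^+ i = 0.
Proof.
move=> b0 <- <- <- rel; apply/eqP.
rewrite -(mulIr_eq0 _ (mulIf (expf_neq0 (3 * N) b0))) -[X in _ == X]rel.
apply/eqP.
rewrite mulr_suml; apply: eq_bigr => i _.
rewrite !mulr_suml; apply: eq_bigr => j _.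
rewrite !mulr_suml; apply: eq_bigr => k _.
have eN : (3 * N = i + j + k + (3 * N - (i + j + k)))%N.
  by rewrite subnKC // 2!mulSn mul1n addnA !leq_add // ltnW.
rewrite {1}eN !exprMn !exprD; ring.
Qed.

Section SurfaceRelation.
Variables (K : fieldType) (f : {mpoly K[3]}).
Hypothesis f0 : f != 0.

(** Three fractions with a common denominator [b] satisfy a polynomial relation
    modulo [f].  It is found by linear algebra: the products of powers of the
    numerators and of [b], together with the multiples of [f] by monomials, are
    more numerous than the monomials of the degree that they reach.  A relation
    among the multiples of [f] alone is trivial, hence the numerators occur. *)
Lemma surface_form_relation (a1 a2 a3 b : {mpoly K[3]}) :
  exists N (c : 'I_N -> 'I_N -> 'I_N -> K),
    (exists i j k, c i j k != 0) /\
    exists h, \sum_i \sum_j \sum_k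
      c i j k *: (a1 ^+ i * a2 ^+ j * a3 ^+ k * b ^+ (3 * N - (i + j + k)))
      = h * f.
Proof.
pose d := (msize f).-1.
pose e := maxn (maxn (msize a1) (msize a2)) (maxn (msize a3) (msize b)).
have szs : [/\ msize a1 <= e.+1, msize a2 <= e.+1, msize a3 <= e.+1
             & msize b <= e.+1]%N.
  by split; apply: leqW; rewrite !leq_max leqnn ?orbT.
have [s1 s2 s3 s4] := szs.
(* All these polynomials have degree less than B + d <= N * (3e + 1 + d), so
   N^3 exceeds the bound d * (B + d)^2 on the number of monomials of degree
   at least B as soon as N is larger than d * (3e + 1 + d)^2. *)
pose N := (d * (3 * e + 1 + d) ^ 2).+1.
pose B := (3 * N * e).+1.
pose I := ('I_N * 'I_N * 'I_N + 'X_{1..3 < B})%type.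
pose p (i : I) : {mpoly K[3]} := match i with
  | inl (i, j, k) => a1 ^+ i * a2 ^+ j * a3 ^+ k * b ^+ (3 * N - (i + j + k))
  | inr m => 'X_[m] * f end.
have p_size i : (msize (p i) <= B + d)%N.
  case: i => [[[i j] k]|m] /=.
    have := msizeM_le (msizeM_le (msizeM_le (msizeX_le i s1) (msizeX_le j s2))
      (msizeX_le k s3)) (msizeX_le (3 * N - (i + j + k)) s4).
    rewrite -!mulnDl subnKC; last first.
      by rewrite 2!mulSn mul1n addnA !leq_add // ltnW.
    by move=> h; apply: leq_trans h (leq_addr _ _).
  have := @msizeM_le K 3 'X_[m] f (3 * N * e) d.
  rewrite msizeX /B addSn; apply; first exact: bmdeg.
  by rewrite /d prednK // lt0n msize_poly_eq0.
have card_lt : (#|{: 'X_{1..3 < B + d}}| < #|{: I}|)%N.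
  apply: leq_ltn_trans (card_monomials_shift B d) _.
  rewrite card_sum !card_prod !card_ord addnC ltn_add2r.
  have BN : (B + d <= N * (3 * e + 1 + d))%N.
    rewrite /B -addn1 -addnA -(addnA (3 * e)) mulnDr (mulnC 3) -mulnA.
    by rewrite leq_add2l mulnDr muln1 leq_add // leq_pmull.
  apply: (@leq_ltn_trans (d * (N * (3 * e + 1 + d)) ^ 2)).
    by rewrite leq_mul2l leq_exp2r // BN orbT.
  by rewrite expnMn mulnCA -mulnn ltn_pmul2l // muln_gt0.
have [c [[i0 ci0]]] := mpoly_relation p_size card_lt.
rewrite big_sumType /= => rel.
exists N, (fun i j k => c (inl (i, j, k))); split; last first.
  exists (- \sum_m c (inr m) *: 'X_[m : 'X_{1..3}]).
  rewrite mulNr mulr_suml; apply/eqP; rewrite -addr_eq0; apply/eqP.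
  rewrite -[RHS]rel; congr (_ + _); last first.
    by apply: eq_bigr => m _; rewrite scalerAl.
  rewrite pair_big /= pair_big /=; apply: eq_bigr => -[[i j] k] _ //.
case: (pselect (exists i j k, c (inl (i, j, k)) != 0)) => // none.
have c1 i : c (inl i) = 0.
  case: i => [[i j] k]; apply/eqP/negP => /negP h; apply: none.
  by exists i, j, k.
case: i0 ci0 => [i|m]; first by rewrite c1 eqxx.
move=> /eqP; case.
move: rel; rewrite big1 => [|i _]; last by rewrite c1 scale0r.
rewrite add0r => rel.
have : (\sum_m c (inr m) *: 'X_[m : 'X_{1..3}]) * f = 0.
  by rewrite mulr_suml -[RHS]rel; apply: eq_bigr => m' _; rewrite scalerAl.
move=> /eqP; rewrite mulf_eq0 (negPf f0) orbF => /eqP.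
move/(congr1 (mcoeff m)); rewrite mcoeff0 raddf_sum /= (bigD1 m) //= big1.
  by rewrite addr0 mcoeffZ mcoeffX eqxx mulr1.
by move=> m' ne; rewrite mcoeffZ mcoeffX -bmeqP (negPf ne) mulr0.
Qed.

Variables (D : idomainType) (res : {rmorphism {mpoly K[3]} -> D}).
Hypothesis res_surj : forall x, exists p, res p = x.
Hypothesis res_f : res f = 0.

Lemma recip_compl_relation (y1 y2 y3 : recip_compl D) :
  satisfies_relation (const_recip (res \o @mpolyC 3 K)) y1 y2 y3.
Proof.
have [a1 [b1 [b10 e1]]] := fraction_repr (val y1).
have [a2 [b2 [b20 e2]]] := fraction_repr (val y2).
have [a3 [b3 [b30 e3]]] := fraction_repr (val y3).
have [A1 eA1] := res_surj (a1 * b2 * b3).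
have [A2 eA2] := res_surj (a2 * b1 * b3).
have [A3 eA3] := res_surj (a3 * b1 * b2).
have [B eB] := res_surj (b1 * b2 * b3).
have [N [c [c0 [h rel]]]] := surface_form_relation A1 A2 A3 B.
exists N, c; split=> //.
pose F : {rmorphism {mpoly K[3]} -> {fraction D}} := (@tofrac D \o res).
have nz1 := b10; have nz2 := b20; have nz3 := b30.
rewrite -(tofrac_eq0 b1) in nz1; rewrite -(tofrac_eq0 b2) in nz2.
rewrite -(tofrac_eq0 b3) in nz3.
have B0 : F B != 0 by rewrite /F /= eB !tofracM !mulf_neq0.
have E1 : val y1 * F B = F A1.
  by rewrite /F /= eB eA1 e1 !tofracM clear_denominator.
have E2 : val y2 * F B = F A2.
  by rewrite /F /= eB eA2 e2 !tofracM (mulrC (tofrac b1)) clear_denominator.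
have E3 : val y3 * F B = F A3.
  rewrite /F /= eB eA3 e3 !tofracM (mulrC (tofrac b1 * _)).
  by rewrite (mulrA (tofrac b3)) clear_denominator.
apply: val_inj; rewrite rmorph0.
have := dehomogenized_relation (c := fun i j k => F (c i j k)%:MP) B0 E1 E2 E3.
suff -> : \sum_i \sum_j \sum_k F (c i j k)%:MP *
    (F A1 ^+ i * F A2 ^+ j * F A3 ^+ k * F B ^+ (3 * N - (i + j + k))) = 0.
  move=> /(_ erefl) <-; rewrite rmorph_sum; apply: eq_bigr => i _.
  rewrite rmorphM rmorphXn rmorph_sum; congr (_ * _); apply: eq_bigr => j _.
  rewrite rmorphM rmorphXn rmorph_sum; congr (_ * _); apply: eq_bigr => k _.
  by rewrite rmorphM rmorphXn.
transitivity (F (h * f)); last by rewrite rmorphM [F f]/= res_f tofrac0 mulr0.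
rewrite -rel (rmorph_sum F). apply: eq_bigr => i _.
rewrite (rmorph_sum F); apply: eq_bigr => j _.
rewrite (rmorph_sum F); apply: eq_bigr => k _.
by rewrite -mul_mpolyC !(rmorphM F) !(rmorphXn F).
Qed.

End SurfaceRelation.

(** * Valuations of a quotient ring *)

Section Transport.

Lemma degree_preorder_pullback (A B : idomainType) (phi : {rmorphism A -> B})
    (le : B -> B -> Prop) :
    injective phi -> degree_preorder le ->
  degree_preorder (fun p q => le (phi p) (phi q)).
Proof.
move=> phi_inj leP; split.
- by move=> a b; apply: (le_total leP).
- by move=> b a c; apply: (le_trans leP).
- by move=> a b c; rewrite rmorphB; apply: (le_sub leP).
- move=> a b c c0; rewrite !rmorphM; apply: (le_mul leP).
  by rewrite -(rmorph0 phi) (inj_eq phi_inj).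
- move=> a a0; rewrite rmorph1; apply: (le_one leP).
  by rewrite -(rmorph0 phi) (inj_eq phi_inj).
- by rewrite rmorph1 rmorph0; apply: (le_one0 leP).
Qed.

Variables (M D : idomainType) (res : {rmorphism M -> D}) (good : M -> Prop).
Hypothesis good1 : good 1.
Hypothesis goodM : forall p q, good p -> good q -> good (p * q).
Hypothesis good_lift : forall x, exists p, good p /\ res p = x.

(** The class [good] of polynomials is meant to consist of representatives of
    smallest degree in their class modulo the kernel of [res]; the degree of a
    class is then read off on any good representative. *)
Definition chosen_rep (x : D) : M := projT1 (cid (good_lift x)).

Let lift_good x : good (chosen_rep x).
Proof. by rewrite /chosen_rep; case: cid => p [] /=. Qed.

Let liftK x : res (chosen_rep x) = x.
Proof. by rewrite /chosen_rep; case: cid => p [] /=. Qed.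

Definition residual_le (le : M -> M -> Prop) (x y : D) : Prop :=
  le (chosen_rep x) (chosen_rep y).

Variable le : M -> M -> Prop.
Hypothesis leP : degree_preorder le.
Hypothesis good_minimal : forall p q, good p -> res p = res q -> le p q.

Lemma residual_leE p q : good p -> good q ->
  residual_le le (res p) (res q) <-> le p q.
Proof.
move=> gp gq; rewrite /residual_le; split=> h.
  apply: (le_trans leP (b := chosen_rep (res p))); first exact: good_minimal.
  by apply: (le_trans leP h); apply: good_minimal.
apply: (le_trans leP (b := p)); first exact: good_minimal.
by apply: (le_trans leP h); apply: good_minimal.
Qed.

(** The preorder on classes is compatible with multiplication because products
    of good representatives are good. *)
Lemma degree_preorder_residual : degree_preorder (residual_le le).
Proof.
have lift0 x : x != 0 -> chosen_rep x != 0.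
  by apply: contra_neq => e; rewrite -(liftK x) e rmorph0.
split.
- by move=> a b; apply: (le_total leP).
- by move=> b a c; apply: (le_trans leP).
- move=> a b c ac bc; apply: (le_trans leP (b := chosen_rep a - chosen_rep b)).
    by apply: good_minimal; rewrite ?rmorphB ?liftK.
  exact: (le_sub leP).
- move=> a b c c0; have := residual_leE (goodM (lift_good a) (lift_good c))
    (goodM (lift_good b) (lift_good c)).
  rewrite !rmorphM !liftK => e.
  have m := le_mul leP (chosen_rep a) (chosen_rep b) (lift0 _ c0).
  by split=> [/e /m //|h]; apply/e/m.
- move=> a a0; apply: (le_trans leP (b := 1)).
    by apply: good_minimal; rewrite ?liftK ?rmorph1.
  by apply: (le_one leP); apply: lift0.
- move=> h; apply: (le_one0 leP); apply: (le_trans leP (b := chosen_rep 1)).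
    by apply: good_minimal; rewrite ?liftK ?rmorph1.
  apply: (le_trans leP h); by apply: good_minimal; rewrite ?liftK ?rmorph0.
Qed.

End Transport.

(** * Degree and lexicographic degree of iterated polynomials *)

Section IteratedDegree.
Variable A : idomainType.
Implicit Types P Q R : {poly {poly A}}.

Definition size_le P Q : Prop := (size P <= size Q)%N.

(** Comparison of the pairs formed by the degree and the degree of the leading
    coefficient, in lexicographic order.  Looking at the coefficient of [P] in
    the degree of [Q] spares a case distinction: it is [0] if [P] has smaller
    degree than [Q]. *)
Definition lex_le P Q : Prop :=
  (size P <= size Q)%N /\ (size (P`_(size Q).-1)%R <= size (lead_coef Q))%N.

Lemma size_mul_le (B : idomainType) (a b c : {poly B}) : c != 0 ->
  (size (a * c)%R <= size (b * c)%R)%N = (size a <= size b)%N.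
Proof.
move=> c0; have [->|a0] := eqVneq a 0; first by rewrite mul0r size_poly0.
have [->|b0] := eqVneq b 0.
  by rewrite mul0r size_poly0 !leqn0 !size_poly_eq0 mulf_eq0 (negPf c0) orbF.
rewrite !size_mul // -(prednK (n := size c)) ?size_poly_gt0 // !addnS /=.
by rewrite leq_add2r.
Qed.

Lemma size_le_preorder : degree_preorder size_le.
Proof.
split; rewrite /size_le.
- by move=> a b; apply/orP; apply: leq_total.
- by move=> b a c; apply: leq_trans.
- move=> a b c ac bc; apply: leq_trans (size_polyD _ _) _.
  by rewrite size_polyN geq_max ac.
- by move=> a b c c0; rewrite size_mul_le.
- by move=> a a0; rewrite size_poly1 size_poly_gt0.
- by rewrite size_poly1 size_poly0.
Qed.

Lemma coef_predM P Q R : (size P <= size R)%N -> R != 0 -> Q != 0 ->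
  (P * Q)`_(size (R * Q)%R).-1 = P`_(size R).-1 * lead_coef Q.
Proof.
move=> sPR R0 Q0; rewrite size_mul // lead_coefE.
have R_gt0 : (0 < size R)%N by rewrite size_poly_gt0.
have Q_gt0 : (0 < size Q)%N by rewrite size_poly_gt0.
rewrite -{1}(prednK R_gt0) -{1}(prednK Q_gt0) addSn addnS /=.
by apply: coefM_top; rewrite prednK.
Qed.

Lemma coef_pred_small P Q : (size P < size Q)%N -> P`_(size Q).-1 = 0.
Proof.
by move=> h; rewrite nth_default // -ltnS prednK // (leq_ltn_trans _ h).
Qed.

Lemma lex_le_preorder : degree_preorder lex_le.
Proof.
split; rewrite /lex_le.
- move=> a b; case: (ltngtP (size a) (size b)) => h.
  + by left; split=> //; rewrite coef_pred_small ?size_poly0.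
  + by right; split=> //; rewrite coef_pred_small ?size_poly0.
  + rewrite -h -lead_coefE h -lead_coefE.
    by case/orP: (leq_total (size (lead_coef a)) (size (lead_coef b)));
      [left|right].
- move=> b a c [ab lab] [bc lbc]; split; first exact: leq_trans bc.
  case: (ltngtP (size b) (size c)) bc => // h _.
    by rewrite coef_pred_small ?size_poly0 // (leq_ltn_trans ab).
  by rewrite -h (leq_trans lab) // lead_coefE h.
- move=> a b c [ac lac] [bc lbc]; split.
    exact: (le_sub size_le_preorder).
  by rewrite coefB (leq_trans (size_polyD _ _)) // size_polyN geq_max lac.
- move=> a b c c0; have [->|b0] := eqVneq b 0.
    rewrite mul0r lead_coef0 !size_poly0 !leqn0 !size_poly_eq0 mulf_eq0.
    by rewrite (negPf c0) orbF; split=> -[/eqP -> _]; rewrite ?mul0r coef0.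
  have lc0 : lead_coef c != 0 by rewrite lead_coef_eq0.
  rewrite size_mul_le //; split=> -[ac]; rewrite coef_predM // lead_coefM;
    by rewrite size_mul_le.
- move=> a a0; rewrite size_poly1 size_poly_gt0 a0 coef1; split=> //.
  apply: (@leq_trans 1); last by rewrite size_poly_gt0 lead_coef_eq0.
  by case: eqP; rewrite ?size_poly1 ?size_poly0.
- by rewrite size_poly1 size_poly0 => -[].
Qed.

(** Subtracting a polynomial of smaller lexicographic degree does not change
    the leading part. *)
Lemma lex_le_lead P Q : lex_le Q P -> ~ lex_le P Q ->
  lead_coef (lead_coef (P - Q)) = lead_coef (lead_coef P).
Proof.
move=> [sQP lQP] nPQ; case: (ltngtP (size Q) (size P)) sQP => // h _.
  by rewrite lead_coefDl // size_polyN.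
have lt : (size (- Q`_(size P).-1)%R < size (lead_coef P))%N.
  rewrite size_polyN ltnNge; apply/negP => l; apply: nPQ.
  by rewrite /lex_le h leqnn -lead_coefE [lead_coef Q]lead_coefE h; split.
have cPQ : lead_coef ((P - Q)`_(size P).-1) = lead_coef (lead_coef P).
  by rewrite coefB -lead_coefE lead_coefDl.
suff sPQ : size (P - Q) = size P by rewrite (lead_coefE (P - Q)) sPQ.
apply/eqP; rewrite eqn_leq (leq_trans (size_polyD _ _)) /=; last first.
  by rewrite size_polyN h maxnn.
rewrite leqNgt; apply/negP => /coef_pred_small e; move: lt cPQ; rewrite e.
rewrite lead_coef0 => lt /esym/eqP; rewrite lead_coef_eq0 => /eqP lP0.
by move: lt; rewrite lP0 size_poly0.
Qed.

End IteratedDegree.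

(** * The degree in Y and Z, refined by the degree in X *)

Section Bidegree.
Variable K : fieldType.
Local Notation M := {mpoly K[3]}.

(** With [K[T][s][t]] as iterated polynomial ring, [X] goes to [s], [Y] to [t]
    and [Z] to [T t].  The degree in [t] is the degree in [Y] and [Z], the
    degree in [s] of the leading coefficient is, up to sign, the second
    component of the valuation, and the leading coefficient that remains is a binary form in
    [Y] and [Z], written as a polynomial in the slope [T = Z/Y]. *)
Definition biexpand_var (i : 'I_3) : {poly {poly {poly K}}} :=
  nth 0 [:: 'X%:P; 'X; ('X%:P)%:P * 'X] i.

Definition biexpand : M -> {poly {poly {poly K}}} :=
  mmap (@polyC {poly {poly K}} \o (@polyC {poly K} \o @polyC K)) biexpand_var.

HB.instance Definition _ := GRing.RMorphism.copy biexpand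
  (mmap (@polyC {poly {poly K}} \o (@polyC {poly K} \o @polyC K)) biexpand_var).

Lemma biexpandX (m : 'X_{1..3}) :
  biexpand 'X_[m] = (('X^(m 2%:R))%:P * 'X^(m 0%R))%:P * 'X^(m 1%R + m 2%:R).
Proof.
have shuffle (R : comNzRingType) (a b c e : R) :
    a * (b * (c * e)) = c * a * (b * e).
  by ring.
rewrite /biexpand mmapX /mmap1 3!big_ord_recl big_ord0 mulr1.
rewrite /biexpand_var /= exprMn exprD polyCM !rmorphXn /=.
have -> : lift ord0 (lift ord0 ord0) = 2%:R :> 'I_3 by apply: val_inj.
have -> : lift ord0 ord0 = 1%R :> 'I_3 by apply: val_inj.
exact: shuffle.
Qed.

Lemma biexpandZ c (p : M) : biexpand (c *: p) = c%:P%:P%:P * biexpand p.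
Proof. exact: mmapZ. Qed.

Lemma biexpandB (p q : M) : biexpand (p - q) = biexpand p - biexpand q.
Proof. exact: rmorphB. Qed.

Lemma biexpandBM (p h f : M) :
  biexpand (p - h * f) = biexpand p - biexpand h * biexpand f.
Proof. by rewrite biexpandB rmorphM. Qed.

Lemma coef_biexpand (p : M) i j k :
  (biexpand p)`_i`_j`_k = if (k <= i)%N then p@_(mnm3 j (i - k) k) else 0.
Proof.
have -> : biexpand p = \sum_(m <- msupp p) biexpand (p@_m *: 'X_[m]).
  by rewrite -rmorph_sum -mpolyE.
have -> : p@_(mnm3 j (i - k) k) =
    \sum_(m <- msupp p) p@_m * (m == mnm3 j (i - k) k)%:R.
  transitivity ((\sum_(m <- msupp p) p@_m *: 'X_[m])@_(mnm3 j (i - k) k)).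
    by rewrite -mpolyE.
  by rewrite raddf_sum; apply: eq_bigr => m _; rewrite /= mcoeffZ mcoeffX.
have e m : (biexpand (p@_m *: 'X_[m]))`_i`_j`_k =
    if (k <= i)%N then p@_m * (m == mnm3 j (i - k) k)%:R else 0.
  rewrite biexpandZ !coefCM biexpandX coefCM coefXn mulr_natr !coefMn.
  rewrite coefCM coefXn mulr_natr coefMn coefXn mnm3P.
  rewrite [k == _]eq_sym [j == _]eq_sym; case: (m 2%:R =P k) => [mk|] /=.
    case: (m 0%R =P j) => [mj|] /=; rewrite ?mulr0n ?mul0rn ?mulr0 ?if_same //.
    rewrite mk mulr1n; case: leqP => ki; last first.
      by rewrite ltn_eqF ?mulr0n ?mulr0 // (leq_trans ki) // leq_addl.
    by rewrite andbT -(eqn_add2r k (m 1%R)) subnK // eq_sym.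
  by rewrite !andbF !mul0rn mulr0 if_same.
rewrite !coef_sum; case: ifP => ki; last by rewrite big1 // => m _; rewrite e ki.
by apply: eq_bigr => m _; rewrite e ki.
Qed.

Lemma biexpand_inj : injective biexpand.
Proof.
move=> p q e; apply/mpolyP => m.
have -> : m = mnm3 (m 0%R) (m 1%R + m 2%:R - m 2%:R) (m 2%:R).
  by apply/eqP; rewrite mnm3P addnK !eqxx.
have := congr1 (fun P : {poly {poly {poly K}}} =>
  P`_(m 1%R + m 2%:R)`_(m 0%R)`_(m 2%:R)) e.
by rewrite !coef_biexpand leq_addl.
Qed.

(** The restriction of the top form of [f] to the line [X = 0], in the affine
    coordinate [T = Z/Y]. *)
Definition edge_poly (f : M) : {poly K} :=
  \poly_(k < msize f) f@_(mnm3 0 ((msize f).-1 - k) k).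

End Bidegree.

Section SurfaceValuation.
Variables (K : fieldType) (f : {mpoly K[3]}).
Local Notation M := {mpoly K[3]}.
Local Notation d := (msize f).-1.
Local Notation gamma := (edge_poly f).
Hypothesis f0 : f != 0.

Let msize_f : msize f = d.+1.
Proof. by rewrite prednK // lt0n msize_poly_eq0. Qed.

Lemma coef_biexpand_gt i : (d < i)%N -> (biexpand f)`_i = 0.
Proof.
move=> di; apply/polyP => j; apply/polyP => k; rewrite coef_biexpand !coef0.
case: ifP => // ki; apply/memN_msupp_eq0/msize_mdeg_ge.
by rewrite mdeg3 !mnmE /= -addnA subnK // msize_f (leq_trans di) // leq_addl.
Qed.

(** A monomial of the top form whose degree in [Y] and [Z] is already [d]
    cannot contain [X]. *)
Lemma coef_biexpand_edge : (biexpand f)`_d = gamma%:P.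
Proof.
apply/polyP => j; apply/polyP => k; rewrite coef_biexpand coefC.
case: (posnP j) => [->|j0].
  rewrite /edge_poly coef_poly; congr (if _ then _ else _).
  by rewrite [in RHS]msize_f ltnS.
rewrite coef0; case: ifP => // ki.
apply/memN_msupp_eq0/msize_mdeg_ge.
by rewrite mdeg3 !mnmE /= -addnA subnK // {1}msize_f -addn1 addnC leq_add2r.
Qed.

Hypothesis gamma_size : size gamma = d.+1.
Hypothesis gamma_irr : irreducible_poly gamma.

Lemma size_biexpand_f : size (biexpand f) = d.+1.
Proof.
apply/eqP; rewrite eqn_leq; apply/andP; split.
  by apply/leq_sizeP => i di; apply: coef_biexpand_gt.
apply: coef_neq0_size; rewrite coef_biexpand_edge polyC_eq0; exact: irredp_neq0.
Qed.

Definition bilead (p : M) : {poly K} := lead_coef (lead_coef (biexpand p)).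

Lemma bilead_f : bilead f = gamma.
Proof.
rewrite /bilead (lead_coefE (biexpand f)) size_biexpand_f coef_biexpand_edge.
exact: lead_coefC.
Qed.

Lemma bileadM p q : bilead (p * q) = bilead p * bilead q.
Proof. by rewrite /bilead rmorphM !lead_coefM. Qed.

(** The leading part of a polynomial that is not reduced, a power of [X] times
    a form in [Y] and [Z], is a multiple of that of [f] and can be cancelled. *)
Definition reduced (p : M) : Prop := p = 0 \/ ~~ (gamma %| bilead p).

Lemma reduced1 : reduced 1.
Proof.
right; rewrite /bilead rmorph1 !lead_coef1 dvdp1.
by rewrite neq_ltn gamma_irr.1 orbT.
Qed.

(** This is where the irreducibility of the form at infinity is used: it makes
    the degree additive on the quotient by [f]. *)
Lemma reducedM p q : reduced p -> reduced q -> reduced (p * q).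
Proof.
move=> [->|hp]; first by rewrite mul0r; left.
move=> [->|hq]; first by rewrite mulr0; left.
right; rewrite bileadM; suff co : coprimep gamma (bilead p).
  by rewrite (Gauss_dvdpr _ co).
rewrite coprimep_def; apply: contraNT hp => ne.
have /eqp_dvdl <- := gamma_irr.2 _ ne (dvdp_gcdl gamma (bilead p)).
exact: dvdp_gcdr.
Qed.

(** If [bilead p = q * gamma], then the multiple of [f] to be subtracted is
    [h * f], where [h] is the homogenization of [q] in [Y] and [Z] of degree
    [i - d], times [X^j].  Such an [h] exists because the degree of [bilead p]
    in the slope [T] is at most [i], so that [q] has degree at most [i - d]. *)
Lemma bidegree_reduction (p : M) i j :
    size (biexpand p) = i.+1 -> size (biexpand p)`_i = j.+1 ->
    gamma %| bilead p ->
  exists h, (size (biexpand (p - h * f)) <= i.+1)%N /\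
            (size ((biexpand (p - h * f))`_i)%R <= j)%N.
Proof.
move=> si sj /dvdpP [q eq].
have lp : lead_coef (biexpand p) = (biexpand p)`_i by rewrite lead_coefE si.
have lp2 : bilead p = (biexpand p)`_i`_j.
  by rewrite /bilead lp lead_coefE sj.
have p0 : bilead p != 0.
  by rewrite /bilead !lead_coef_eq0 -size_poly_gt0 si.
have q0 : q != 0 by apply: contraNneq p0 => q0; rewrite eq q0 mul0r.
have sq : (size q + d <= i.+1)%N.
  have : (size (bilead p) <= i.+1)%N.
    apply/leq_sizeP => k ik; rewrite lp2 coef_biexpand leqNgt ik //.
  rewrite eq size_mul ?(irredp_neq0 gamma_irr) //.
  by rewrite gamma_size addnS.
have di : (d <= i)%N.
  rewrite -ltnS; apply: leq_trans sq.
  by rewrite -[d.+1]add1n leq_add2r size_poly_gt0.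
have [h eh] : exists h : M, biexpand h = (q%:P * 'X^j)%:P * 'X^(i - d).
  exists (\sum_(k < size q) q`_k *: 'X_[mnm3 j (i - d - k) k]).
  rewrite rmorph_sum -[in RHS](coefK q) poly_def.
  rewrite (rmorph_sum (@polyC _)) mulr_suml (rmorph_sum (@polyC _)) mulr_suml.
  apply: eq_bigr => -[k /= kq] _; rewrite biexpandZ biexpandX !mnmE /=.
  rewrite subnK; last first.
    rewrite -(leq_add2r d) subnK // -ltnS; apply: leq_trans sq.
    by rewrite -addSn leq_add2r.
  by rewrite -mul_polyC !polyCM !mulrA.
exists h; have -> : biexpand (p - h * f) =
    biexpand p - (q%:P * 'X^j)%:P * biexpand f * 'X^(i - d).
  by rewrite biexpandBM eh; congr (_ - _); apply: mulrAC.
split.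
  apply/leq_sizeP => k ik; rewrite coefB nth_default ?si // sub0r.
  rewrite coefMXn; case: ifP => _; first by rewrite oppr0.
  rewrite coefCM coef_biexpand_gt ?mulr0 ?oppr0 //.
  by rewrite ltn_subRL addnC subnKC.
rewrite coefB coefMXn ltnNge leq_subr /= subKn // coefCM coef_biexpand_edge.
apply/leq_sizeP => k jk; rewrite coefB mulrAC -polyCM coefMXn ltnNge jk /=.
rewrite coefC -eq lp2 subn_eq0; case: leqP => kj.
  by rewrite (@anti_leq k j) ?subrr // kj jk.
by rewrite nth_default ?subr0 // sj.
Qed.

(** Reduction terminates: the outer induction is on the degree in [Y] and [Z],
    the inner one on the degree in [X] of the corresponding coefficient. *)
Lemma exists_reduced (p : M) : exists q, reduced q /\ exists h, p = q + h * f.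
Proof.
suff H n m : (size (biexpand p) <= n)%N -> (size ((biexpand p)`_n.-1)%R <= m)%N ->
    exists q, reduced q /\ exists h, p = q + h * f by apply: H (leqnn _) (leqnn _).
elim: n m p => [|n IHn] m p.
  rewrite leqn0 size_poly_eq0 -(rmorph0 (@biexpand K)) => /eqP /biexpand_inj -> _.
  by exists 0; split; [left | exists 0; rewrite mul0r addr0].
elim: m p => [|m IHm] p sp /=.
  rewrite leqn0 size_poly_eq0 => /eqP pn; apply: IHn (leqnn _).
  apply/leq_sizeP => i; rewrite leq_eqVlt => /orP [/eqP <- //|ni].
  exact: (leq_sizeP _ _ sp).
rewrite leq_eqVlt => /orP [/eqP sm|]; last exact: IHm.
have sn : size (biexpand p) = n.+1.
  apply/eqP; rewrite eqn_leq sp; apply: coef_neq0_size.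
  by rewrite -size_poly_gt0 sm.
have [dv|ndv] := boolP (gamma %| bilead p); last first.
  by exists p; split; [right | exists 0; rewrite mul0r addr0].
have [h [s1 s2]] := bidegree_reduction sn sm dv.
have [q [qr [h' e]]] := IHm _ s1 s2.
exists q; split=> //; exists (h' + h).
by rewrite mulrDl addrA -e subrK.
Qed.

(** Otherwise [p] and the multiple [p - q] of [f] would have the same leading
    part, and [p] would not be reduced. *)
Lemma reduced_minimal p q h : reduced p -> q = p + h * f ->
  lex_le (biexpand p) (biexpand q).
Proof.
move=> rp eq; apply: contrapT => npq.
case: rp => [p0|/negP []].
  case: npq; rewrite p0 rmorph0; split; rewrite ?size_poly0 // coef0 size_poly0 //.
case: (le_total (@lex_le_preorder {poly K}) (biexpand q) (biexpand p)) =>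
  [qp|/npq []].
rewrite /bilead -(lex_le_lead qp npq) -biexpandB.
have -> : p - q = - h * f by rewrite eq opprD addNKr mulNr.
by rewrite -/(bilead _) bileadM bilead_f dvdp_mull.
Qed.

Variables (D : idomainType) (res : {rmorphism M -> D}).
Hypothesis res_surj : forall x, exists p, res p = x.
Hypothesis res_ker : forall p, res p = 0 <-> exists h, p = h * f.

Let reduced_lift x : exists p, reduced p /\ res p = x.
Proof.
have [p <-] := res_surj x; have [q [qr [h ->]]] := exists_reduced p.
exists q; split=> //; have /res_ker e : exists h', h * f = h' * f by exists h.
by rewrite rmorphD e addr0.
Qed.

Lemma biexpand_variable i : biexpand 'X_i = biexpand_var K i.
Proof. by rewrite /biexpand mmapX mmap1U. Qed.

(** The two centers belong to the degree in [Y] and [Z] and to its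
    lexicographic refinement by the degree in [X]; they are distinguished by
    [1/X], whereas [1/Y] shows that the first is not zero. *)
Lemma surface_chain :
  exists P : 'I_3 -> prime_idealr (recip_compl D), prime_chain P.
Proof.
have lexP := degree_preorder_pullback (@biexpand_inj K)
  (@lex_le_preorder {poly K}).
have sizeP := degree_preorder_pullback (@biexpand_inj K)
  (@size_le_preorder {poly K}).
have lex_min p q : reduced p -> res p = res q ->
    lex_le (biexpand p) (biexpand q).
  move=> rp e; have [h eh] : exists h, q - p = h * f.
    by apply/res_ker; rewrite rmorphB e subrr.
  by apply: (reduced_minimal (h := h)) rp _; rewrite -eh addrC subrK.
have size_min p q : reduced p -> res p = res q ->
    size_le (biexpand p) (biexpand q) by move=> rp /(lex_min _ _ rp) [].
have monic_reduced p : bilead p = 1 -> reduced p.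
  move=> e; right; rewrite e dvdp1.
  by rewrite neq_ltn gamma_irr.1 orbT.
have r0 : reduced 'X_0.
  apply: monic_reduced; rewrite /bilead biexpand_variable /=.
  by rewrite lead_coefC lead_coefX.
have r1 : reduced 'X_1.
  apply: monic_reduced; rewrite /bilead biexpand_variable /=.
  by rewrite lead_coefX lead_coef1.
have le1P :=
  degree_preorder_residual reduced1 reducedM reduced_lift sizeP size_min.
have le2P :=
  degree_preorder_residual reduced1 reducedM reduced_lift lexP lex_min.
apply: (two_step_chain le1P le2P (x := res 'X_0) (y := res 'X_1)).
- by move=> a b [].
- rewrite -(rmorph1 res).
  apply/(residual_leE reduced_lift sizeP size_min r0 reduced1).
  change (size_le (biexpand ('X_0 : M)) (biexpand (1 : M))).
  by rewrite biexpand_variable rmorph1 /size_le size_polyC size_poly1 polyX_eq0.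
- rewrite -(rmorph1 res).
  move=> /(residual_leE reduced_lift lexP lex_min r0 reduced1).
  change (~ lex_le (biexpand ('X_0 : M)) (biexpand (1 : M))).
  rewrite biexpand_variable rmorph1 => -[_].
  by rewrite size_poly1 lead_coef1 size_poly1 coefC size_polyX.
- rewrite -(rmorph1 res).
  move=> /(residual_leE reduced_lift sizeP size_min r1 reduced1).
  change (~ size_le (biexpand ('X_1 : M)) (biexpand (1 : M))).
  by rewrite biexpand_variable rmorph1 /size_le size_polyX size_poly1.
Qed.

End SurfaceValuation.

(** * Restriction to lines and a Nullstellensatz for hypersurfaces *)

Section Vanishing.
Variable K : fieldType.
Hypothesis K_infinite : infinite_set [set: K]%classic.

Lemma ex_notin (s : seq K) : exists a, a \notin s.
Proof.
apply: contrapT => none; apply: K_infinite.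
apply: (sub_finite_set _ (finite_seq s)) => a _ /=.
by apply: contrapT => as_; apply: none; exists a; apply/negP.
Qed.

(** The coefficients live in a larger domain [R]: this is what the induction on
    the number of variables in [mpoly_ex_nonzero] needs. *)
Lemma ex_nonroot (R : idomainType) (phi : K -> R) (P : {poly R}) :
  injective phi -> P != 0 -> exists a, P.[phi a] != 0.
Proof.
move=> phi_inj P0; apply: contrapT => none.
have rootP a : root P (phi a).
  by apply/negP => /negP h; apply: none; exists a.
have [s us ss] : exists2 s : seq K, uniq s & size s = size P.
  elim: (size P) => [|n [s us ss]]; first by exists [::].
  by have [a as_] := ex_notin s; exists (a :: s); rewrite /= ?as_ ?ss.
have := max_poly_roots (rs := map phi s) P0.
rewrite map_inj_uniq // size_map ss ltnn => h; have : false; last by [].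
by apply: h => //; apply/allP => _ /mapP [a _ ->].
Qed.

Lemma coef_muni n (p : {mpoly K[n.+1]}) (m : 'X_{1..n.+1}) :
  (muni p)`_(m ord_max)@_[multinom m (widen_ord (leqnSn n) i) | i < n] = p@_m.
Proof.
rewrite muniE coef_sum raddf_sum /=.
transitivity ((\sum_(l <- msupp p) p@_l *: 'X_[l])@_m); last by rewrite -mpolyE.
rewrite raddf_sum; apply: eq_bigr => l _ /=; rewrite mcoeffZ mcoeffX.
rewrite coefZ coefXn mulr_natr mcoeffMn mcoeffZ mcoeffX -mulrnAr; congr (_ * _).
have [->|ne] := eqVneq l m; first by rewrite !eqxx.
case: eqP => // e; case: eqP => // em; case/eqP: ne; apply/mnmP => i.
have [j ->|->] := unliftP ord_max i; last by rewrite em.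
have -> : lift ord_max j = widen_ord (leqnSn n) j.
  by apply: val_inj; rewrite /= /bump leqNgt ltn_ord.
have := congr1 (fun t : 'X_{1..n} => t j) e.
by rewrite !mnmE.
Qed.

Lemma mpoly_ex_nonzero n (p : {mpoly K[n]}) :
  p != 0 -> exists v : 'I_n -> K, p.@[v] != 0.
Proof.
elim: n p => [|n IHn] p p0.
  exists (fun _ => 0); move: p0; rewrite [p]nvar0_mpolyC mevalC.
  by rewrite mpolyC_eq0.
have : muni p != 0.
  apply: contraNneq p0 => e; apply/eqP/mpolyP => m.
  by rewrite -coef_muni e coef0 !mcoeff0.
move=> /(ex_nonroot (phi := @mpolyC n K)) [|a]; first exact: can_inj (@mpolyCK n K).
move=> /IHn [v]; set q := _.@[v] => q0.
exists (fun i => if unlift ord_max i is Some j then v j else a).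
suff -> : p.@[fun i => if unlift ord_max i is Some j then v j else a] = q by [].
rewrite /q muniE horner_sum raddf_sum /= mevalE; apply: eq_bigr => m _.
rewrite hornerZ hornerXn mevalM mevalZ mevalX rmorphXn /= mevalC -mulrA.
rewrite big_ord_recr /= unlift_none; congr (_ * (_ * _)).
apply: eq_bigr => i _; rewrite mnmE; congr (_ ^+ _).
have -> : widen_ord (leqnSn n) i = lift ord_max i.
  by apply: val_inj; rewrite /= /bump leqNgt ltn_ord.
by rewrite liftK.
Qed.

End Vanishing.

Section Lines.
Variables (n : nat) (K : fieldType) (S : comNzRingType).
Variables (kappa : {rmorphism K -> S}) (a b : 'I_n -> S).

Definition line : {mpoly K[n]} -> {poly S} :=
  mmap (@polyC S \o kappa) (fun i => (a i)%:P + (b i)%:P * 'X).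

HB.instance Definition _ := GRing.RMorphism.copy line
  (mmap (@polyC S \o kappa) (fun i => (a i)%:P + (b i)%:P * 'X)).

Lemma lineC c : line c%:MP = (kappa c)%:P.
Proof. exact: mmapC. Qed.

Lemma lineX i : line 'X_i = (a i)%:P + (b i)%:P * 'X.
Proof. by rewrite /line mmapX mmap1U. Qed.

(** The value at [b] of the form of degree [d] in [p], that is, when [p]
    has degree at most [d], its coefficient of order [d] along any line of
    direction [b]. *)
Definition top_value d (p : {mpoly K[n]}) : S :=
  \sum_(m <- msupp p | mdeg m == d) kappa p@_m * \prod_i b i ^+ m i.

Lemma line_monomial (m : 'X_{1..n}) :
  (size (line 'X_[m]) <= (mdeg m).+1)%N /\
  (line 'X_[m])`_(mdeg m) = \prod_i b i ^+ m i.
Proof.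
rewrite mdegE mpolyXE_id rmorph_prod /=.
apply: (big_ind3 (fun P k c => (size (P : {poly S}) <= k.+1)%N /\ P`_k = c)).
- by rewrite size_poly1 coef1.
- move=> P k c Q l e [sP <-] [sQ <-]; split; last exact: coefM_top.
  apply: leq_trans (size_polyMleq _ _) _.
  rewrite -subn1 leq_subLR add1n; apply: leq_trans (leq_add sP sQ) _.
  by rewrite addSn addnS.
move=> i _; rewrite rmorphXn /= lineX; elim: (m i) => [|k [IHs IHc]].
  by rewrite !expr0 size_poly1 coef1.
have s2 : (size ((a i)%:P + (b i)%:P * 'X)%R <= 2)%N.
  apply: leq_trans (size_polyD _ _) _; rewrite geq_max.
  rewrite (leq_trans (size_polyC_leq1 _)) //=.
  apply: leq_trans (size_polyMleq _ _) _; rewrite size_polyX addn2 /= ltnS.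
  exact: size_polyC_leq1.
rewrite exprS; split.
  apply: leq_trans (size_polyMleq _ _) _.
  by rewrite -subn1 leq_subLR add1n; apply: leq_trans (leq_add s2 IHs) _.
rewrite -add1n coefM_top // IHc add1n exprS.
by rewrite coefD coefC coefMX coefC add0r.
Qed.

Lemma size_line p : (size (line p) <= msize p)%N.
Proof.
rewrite {1}(mpolyE p) rmorph_sum; apply: leq_trans (size_sum _ _ _) _.
rewrite big_tnth; apply/bigmax_leqP => j _; set m := tnth _ _.
have mp : m \in msupp p by apply: mem_tnth.
rewrite -mul_mpolyC rmorphM /= lineC mul_polyC.
apply: leq_trans (size_scale_leq _ _) _.
by apply: leq_trans (line_monomial m).1 _; apply: msize_mdeg_lt.
Qed.

Lemma coef_line_top d p : (msize p <= d.+1)%N -> (line p)`_d = top_value d p.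
Proof.
move=> pd; rewrite {1}(mpolyE p) rmorph_sum coef_sum /top_value [RHS]big_mkcond /=.
apply: eq_big_seq => m mp; rewrite -mul_mpolyC rmorphM /= lineC coefCM.
case: eqP => [<-|/eqP ne]; first by rewrite (line_monomial m).2.
rewrite nth_default ?mulr0 //; apply: leq_trans (line_monomial m).1 _.
by rewrite ltn_neqAle ne -ltnS; apply: leq_trans pd; apply: msize_mdeg_lt.
Qed.

End Lines.

Section Nullstellensatz.
Variables (K : fieldType) (L : closedFieldType) (iota : {rmorphism K -> L}).
Hypothesis K_infinite : infinite_set [set: K]%classic.
Variables (n : nat) (f : {mpoly K[n]}).
Hypothesis f0 : f != 0.
Local Notation M := {mpoly K[n]}.
Local Notation d := (msize f).-1.

Lemma top_value_pihomog (v : 'I_n -> K) :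
  top_value idfun v d f = (pihomog mdeg d f).@[v].
Proof.
rewrite pihomogE raddf_sum /=; apply: eq_bigr => m _.
by rewrite mevalZ mevalX.
Qed.

(** A direction along which [f] keeps its degree on every parallel line; it
    exists since the top form is a nonzero polynomial over an infinite field. *)
Lemma ex_transverse_direction : exists v : 'I_n -> K, top_value idfun v d f != 0.
Proof.
have : pihomog mdeg d f != 0.
  have mf := mlead_supp f0; have : f@_(mlead f) != 0 by rewrite -mcoeff_msupp.
  apply: contraNneq => /(congr1 (mcoeff (mlead f))).
  rewrite mcoeff0 pihomogE raddf_sum /= big_mkcond /=.
  rewrite (bigD1_seq (mlead f)) ?msupp_uniq //= big1 => [|m ne].
    by rewrite addr0 -mlead_deg // eqxx mcoeffZ mcoeffX eqxx mulr1 => ->.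
  by case: eqP => // _; rewrite mcoeffZ mcoeffX (negPf ne) mulr0.
move=> /(mpoly_ex_nonzero K_infinite) [v v0]; exists v.
by rewrite top_value_pihomog.
Qed.

Lemma dvdp_exp_of_roots (F P : {poly L}) :
    F != 0 -> (forall z, root F z -> root P z) ->
  F %| P ^+ (size F).-1.
Proof.
move=> F0 FP; have [r e] := closed_field_poly_normal F.
have lF0 : lead_coef F != 0 by rewrite lead_coef_eq0.
have sr : (size F).-1 = size r.
  by rewrite e size_scale // size_prod_XsubC.
have rP z : z \in r -> root P z.
  move=> zr; apply: FP; rewrite e rootZ // root_prod_XsubC //.
rewrite sr e dvdpZl //; elim: r rP {e sr} => [|z r IHr] rP.
  by rewrite big_nil dvd1p.
rewrite big_cons /= exprS dvdp_mul //; first by rewrite dvdp_XsubCl rP ?inE ?eqxx.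
by apply: IHr => y yr; apply: rP; rewrite inE yr orbT.
Qed.

Lemma eval_at_iota (p : M) (u : 'I_n -> K) :
  eval_at iota p (iota \o u) = iota p.@[u].
Proof.
rewrite /eval_at.
apply: (mpoly_rmorph_eq (phi := (meval (iota \o u) \o map_mpoly iota))
  (psi := (iota \o meval u))) => [c|i] /=.
- by rewrite map_mpolyC !mevalC.
- by rewrite map_mpolyX !mevalXU.
Qed.

Section Restriction.
Variables (u v : 'I_n -> K).

(** The restriction of a polynomial to the line of direction [v] through the
    generic point; [specialize u] moves this line to the point [u]. *)
Definition generic_line : M -> {poly M} :=
  line (@mpolyC n K) (fun i => 'X_i) (fun i => (v i)%:MP).

HB.instance Definition _ := GRing.RMorphism.copy generic_line
  (line (@mpolyC n K) (fun i => 'X_i) (fun i => (v i)%:MP)).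

Definition specialize : {poly M} -> {poly L} := map_poly (iota \o meval u).

HB.instance Definition _ := GRing.RMorphism.copy specialize
  (map_poly (iota \o meval u)).

Lemma horner_specialize (p : M) (t : L) :
  (specialize (generic_line p)).[t] =
  eval_at iota p (fun i => iota (u i) + iota (v i) * t).
Proof.
rewrite /eval_at.
apply: (mpoly_rmorph_eq (phi := (horner_eval t \o specialize \o generic_line))
  (psi := (meval (fun i => iota (u i) + iota (v i) * t) \o map_mpoly iota)))
  => [c|i] /=.
- rewrite map_mpolyC mevalC /generic_line lineC /specialize /= map_polyC /=.
  by rewrite mevalC /horner_eval hornerC.
- rewrite map_mpolyX mevalXU /generic_line lineX /specialize rmorphD rmorphM /=.
  rewrite !map_polyC map_polyX /= mevalXU mevalC /horner_eval.
  by rewrite !hornerE.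
Qed.

End Restriction.

Lemma generic_line0 (v : 'I_n -> K) (p : M) : (generic_line v p).[0] = p.
Proof.
apply: (mpoly_rmorph_eq (phi := (horner_eval 0 \o generic_line v)) (psi := idfun))
  => [c|i] /=.
- by rewrite /generic_line lineC /horner_eval hornerC.
- by rewrite /generic_line lineX /horner_eval !hornerE.
Qed.

Lemma lead_generic_line (v : 'I_n -> K) :
  (generic_line v f)`_d = (top_value idfun v d f)%:MP.
Proof.
rewrite coef_line_top; last by rewrite prednK // lt0n msize_poly_eq0.
rewrite /top_value rmorph_sum; apply: eq_bigr => m _.
rewrite rmorphM rmorph_prod; congr (_ * _).
by apply: eq_bigr => i _; rewrite rmorphXn.
Qed.

(** In a transverse direction [v], the restriction of [f] to the generic line
    has an invertible leading coefficient, hence one can divide by it the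
    restriction of [p ^+ d].  At each point [u] with coordinates in [K], every
    root of [f] along the line is a root of [p], so the restriction of [f],
    which has degree [d], divides that of [p ^+ d], and the remainder vanishes.
    A remainder that vanishes at all points over an infinite field is zero, and
    the division specializes at the origin of the generic line to the
    divisibility of [p ^+ d] by [f]. *)
Lemma nullstellensatz_exp (p : M) :
    (forall x : 'I_n -> L, eval_at iota f x = 0 -> eval_at iota p x = 0) ->
  exists q, p ^+ d = q * f.
Proof.
move=> fp; have [v v0] := ex_transverse_direction.
set c := top_value idfun v d f in v0.
pose F := generic_line v f; pose P := generic_line v p.
have sF : (size F <= d.+1)%N.
  apply: leq_trans (size_line _ _ _ _) _.
  by rewrite prednK // lt0n msize_poly_eq0.
have cF : F`_d = c%:MP by apply: lead_generic_line.
have szF : size F = d.+1.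
  apply/eqP; rewrite eqn_leq sF; apply: coef_neq0_size.
  by rewrite cF mpolyC_eq0.
pose G := (c^-1)%:MP%:P * F.
have cG : G`_d = 1 by rewrite coefCM cF -mpolyCM mulVf.
have szG : size G = d.+1.
  apply/eqP; rewrite eqn_leq; apply/andP; split.
    by rewrite /G mul_polyC (leq_trans (size_scale_leq _ _)).
  by apply: coef_neq0_size; rewrite cG oner_neq0.
have mG : G \is monic by rewrite monicE lead_coefE szG cG.
have e := Pdiv.RingMonic.rdivp_eq mG (P ^+ d).
set Q := Pdiv.Ring.rdivp _ _ in e; set r := Pdiv.Ring.rmodp _ _ in e.
have sr : (size r < size G)%N.
  by apply: Pdiv.Ring.ltn_rmodpN0; rewrite monic_neq0.
have r0 : r = 0.
  apply/polyP => j; rewrite coef0; apply: contrapT => /eqP.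
  move=> /(mpoly_ex_nonzero K_infinite) [u]; apply/negP; rewrite negbK.
  pose E := specialize u.
  have mEG : E G \is monic by apply: monic_map.
  have szEG : size (E G) = d.+1.
    by rewrite -szG size_map_poly_id0 // (monicP mG) rmorph1 oner_neq0.
  have EGF : E G = (iota c^-1)%:P * E F.
    by rewrite /E rmorphM /= /specialize map_polyC /= mevalC.
  have EF0 : E F != 0.
    apply: contraTneq mEG => EF0; rewrite EGF EF0 mulr0 monicE lead_coef0.
    by rewrite eq_sym oner_eq0.
  have szEF : size (E F) = d.+1.
    by rewrite -szEG EGF size_Cmul // fmorph_eq0 invr_eq0.
  have dv : E F %| E P ^+ d.
    have := dvdp_exp_of_roots (P := E P) EF0; rewrite szEF; apply=> z /rootP z0.
    by apply/rootP; rewrite horner_specialize fp // -horner_specialize.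
  have dvG : E G %| E P ^+ d by rewrite EGF mul_polyC dvdpZl // fmorph_eq0 invr_eq0.
  have Er : E r = 0.
    apply/eqP; apply: contraTT dvG => Er0.
    have -> : E P ^+ d = E Q * E G + E r.
      by rewrite /E -rmorphXn e rmorphD rmorphM.
    rewrite dvdp_addr ?dvdp_mull // gtNdvdp // szEG.
    by apply: leq_ltn_trans (size_poly _ _) _; rewrite -szG.
  have := congr1 (fun T : {poly L} => T`_j) Er.
  rewrite coef0 coef_map /= => /eqP; by rewrite fmorph_eq0.
exists (Q.[0] * (c^-1)%:MP).
have := congr1 (horner_eval 0) e; rewrite r0 addr0 rmorphXn rmorphM /=.
by rewrite /horner_eval generic_line0 hornerM hornerC generic_line0 mulrA.
Qed.

Hypothesis fP : principal_is_prime f.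

Lemma nullstellensatz (p : M) :
    (forall x : 'I_n -> L, eval_at iota f x = 0 -> eval_at iota p x = 0) ->
  exists q, p = q * f.
Proof.
move=> /nullstellensatz_exp h.
have : p ^+ d \in principal f by apply/asboolP.
elim: {h}d => [|k IHk].
  by rewrite expr0 => h; case: fP => -[_ /negP].
rewrite exprS => /(fP.2 _ _) /orP [/asboolP //|]; exact: IHk.
Qed.

End Nullstellensatz.

(** * Zeros of the top form are points at infinity *)

Section PointsAtInfinity.
Variables (K : fieldType) (L : closedFieldType) (iota : {rmorphism K -> L}).
Hypothesis K_infinite : infinite_set [set: K]%classic.
Variables (n : nat) (f : {mpoly K[n]}).
Hypothesis f0 : f != 0.
Hypothesis fP : principal_is_prime f.
Local Notation d := (msize f).-1.

Lemma same_point_refl (P : hcoords L n) : same_point iota P P.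
Proof.
exists idfun; split=> //; first by exists idfun.
by exists 1; [exact: oner_neq0 | move=> i; rewrite mul1r].
Qed.

Lemma eval_at_dehomogenize (g : {mpoly K[n.+1]}) (x : 'I_n -> L) :
  eval_at iota (dehomogenize g) x = eval_at iota g (with_one x).
Proof.
rewrite /eval_at /dehomogenize.
set T := [tuple _ | _ < _].
apply: (mpoly_rmorph_eq (phi := (meval x \o map_mpoly iota \o comp_mpoly T))
  (psi := (meval (with_one x) \o map_mpoly iota))) => [c|i] /=.
- by rewrite comp_mpolyC !map_mpolyC !mevalC.
- rewrite comp_mpolyXU -tnth_nth tnth_mktuple map_mpolyX mevalXU /with_one.
  case: unliftP => [j _|_]; first by rewrite map_mpolyX mevalXU.
  by rewrite !rmorph1.
Qed.

Lemma msize_dehomogenize (g : {mpoly K[n.+1]}) :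
  (msize (dehomogenize g) <= msize g)%N.
Proof.
rewrite /dehomogenize; set T := [tuple _ | _ < _].
rewrite comp_mpolyEX; apply: leq_trans (msize_sum _ _ _) _.
rewrite big_tnth; apply/bigmax_leqP => j _; set m := tnth _ _.
have mg : m \in msupp g by apply: mem_tnth.
apply: leq_trans (mmeasureZ_le _ _ _) _.
apply: leq_trans (msize_mdeg_lt mg); rewrite comp_mpolyX mdegE.
apply: (big_ind2 (fun (p : {mpoly K[n]}) k => msize p <= k.+1)%N).
- by rewrite msize1.
- by move=> p k q l; apply: msizeM_le.
move=> i _; rewrite -[X in (_ <= X.+1)%N]muln1; apply: msizeX_le.
rewrite tnth_mktuple /with_one; case: unlift => [k|]; last by rewrite msize1.
by rewrite msizeX mdeg1.
Qed.

Definition at_infinity_coords (a : 'I_n -> K) : 'I_n.+1 -> K :=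
  fun i => if unlift ord0 i is Some j then a j else 0.

(** Along the line of direction [a] through the origin, the dehomogenization of
    [g] is the restriction of [g] to the projective line that joins the origin
    of the affine space to the point at infinity of direction [a]. *)
Lemma line_dehomogenize (g : {mpoly K[n.+1]}) (a : 'I_n -> K) :
  line idfun (fun=> 0) a (dehomogenize g) =
  line idfun (fun i => (i == ord0)%:R) (at_infinity_coords a) g.
Proof.
rewrite /dehomogenize; set T := [tuple _ | _ < _].
apply: (mpoly_rmorph_eq (phi := (line idfun (fun=> 0) a \o comp_mpoly T))
  (psi := line idfun (fun i => (i == ord0)%:R) (at_infinity_coords a)))
  => [c|i] /=.
- by rewrite comp_mpolyC !lineC.
- rewrite comp_mpolyXU -tnth_nth tnth_mktuple lineX /with_one /at_infinity_coords.
  case: unliftP => [j ->|->] /=; first by rewrite lineX.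
  by rewrite rmorph1 mul0r addr0.
Qed.

Lemma top_value_homog e (g : {mpoly K[n.+1]}) (v : 'I_n.+1 -> K) :
  g \is e.-homog -> top_value idfun v e g = g.@[v].
Proof.
move=> /dhomogP ge; rewrite /top_value mevalE big_mkcond /=.
by apply: eq_big_seq => m /ge ->; rewrite eqxx.
Qed.

(** The value of [g] at the point at infinity is the coefficient of order [e]
    of [q * f] along the line of direction [a]; it vanishes because [q] has
    degree at most [e - d] and [f] drops degree along this line. *)
Lemma multiple_vanishes_at_infinity e (g : {mpoly K[n.+1]}) q (a : 'I_n -> K) :
    g \is e.-homog -> dehomogenize g = q * f -> top_value idfun a d f = 0 ->
  g.@[at_infinity_coords a] = 0.
Proof.
move=> ge eqf fa.
have sg : (msize g <= e.+1)%N.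
  apply/bigmax_leqP_seq => m mg _; by rewrite (dhomogP _ _ _ ge).
rewrite -(top_value_homog _ ge).
rewrite -(coef_line_top _ (fun i => (i == ord0)%:R)) // -line_dehomogenize.
rewrite eqf rmorphM /=.
have [q0|q0] := eqVneq q 0; first by rewrite q0 rmorph0 mul0r coef0.
have szf : msize f = d.+1 by rewrite prednK // lt0n msize_poly_eq0.
have szq : (msize q + d <= e.+1)%N.
  apply: leq_trans sg; apply: leq_trans (msize_dehomogenize g).
  by rewrite eqf msizeM // szf addnS.
have q_gt0 : (0 < msize q)%N by rewrite lt0n msize_poly_eq0.
have de : (d <= e)%N.
  rewrite -ltnS; apply: leq_trans szq.
  by rewrite -[d.+1]add1n leq_add2r.
have fd : (line idfun (fun=> 0) a f)`_d = 0.
  by rewrite coef_line_top // -szf.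
rewrite -[e](subnK de) coefM_top.
- by rewrite fd mulr0.
- apply: leq_trans (size_line _ _ _ _) _.
  by rewrite -(leq_add2r d) addSn subnK.
- by apply: leq_trans (size_line _ _ _ _) _; rewrite szf.
Qed.

Lemma at_infinity_coords_neq0 (a : 'I_n -> K) : (exists i, a i != 0) ->
  exists i, (iota \o at_infinity_coords a) i != 0.
Proof.
move=> [i ai]; exists (lift ord0 i).
by rewrite /= /at_infinity_coords liftK fmorph_eq0.
Qed.

Lemma top_form_zero_at_infinity (a : 'I_n -> K) (a0 : exists i, a i != 0) :
    top_value idfun a d f = 0 ->
  at_infinity iota (affine_locus iota f) (HCoords (at_infinity_coords_neq0 a0)).
Proof.
move=> fa; split.
- move=> _ [S [homS ->]] sub g Sg; have [e ge] := homS g Sg.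
  have [q eq] : exists q, dehomogenize g = q * f.
    apply: (nullstellensatz (iota := iota) K_infinite f0 fP) => x fx.
    rewrite eval_at_dehomogenize.
    apply: (sub (affine_point x)) Sg; exists x => //; exact: same_point_refl.
  by rewrite eval_at_iota (multiple_vanishes_at_infinity ge eq fa) rmorph0.
- move=> [x _ [sigma [_ _ [c c0 /(_ ord0)]]]] /=.
  rewrite /at_infinity_coords /with_one unlift_none rmorph0 rmorph1 mulr1.
  by move=> /esym /eqP; rewrite (negPf c0).
Qed.

Lemma top_form_anisotropic :
    (forall P, at_infinity iota (affine_locus iota f) P ->
               ~ K_rational iota P) ->
  forall a : 'I_n -> K, (exists i, a i != 0) -> top_value idfun a d f != 0.
Proof.
move=> noK a a0; apply/eqP => fa.
apply: (noK _ (top_form_zero_at_infinity a0 fa)).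
exists (HCoords (at_infinity_coords_neq0 a0)); split.
  by move=> i; exists (at_infinity_coords a i).
exact: same_point_refl.
Qed.

End PointsAtInfinity.

(** * The top form on the line X = 0 at infinity *)

Section Edge.
Variables (K : fieldType) (f : {mpoly K[3]}).
Hypothesis f0 : f != 0.
Local Notation d := (msize f).-1.
Local Notation gamma := (edge_poly f).

Definition edge_coords (y z : K) (i : 'I_3) : K := nth 0 [:: 0; y; z] i.

(** Setting [s = 0] and [T = t0] in the expansion of [f] restricts [f] to the
    line of direction [(0, 1, t0)]. *)
Lemma horner_edge_poly t : gamma.[t] = top_value idfun (edge_coords 1 t) d f.
Proof.
have szf : msize f = d.+1 by rewrite prednK // lt0n msize_poly_eq0.
have <- : (line idfun (fun=> 0) (edge_coords 1 t) f)`_d =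
    top_value idfun (edge_coords 1 t) d f.
  by apply: coef_line_top; rewrite -szf.
pose E := horner_eval t \o horner_eval (0 : {poly K}).
have <- : map_poly E (biexpand f) = line idfun (fun=> 0) (edge_coords 1 t) f.
  apply: (mpoly_rmorph_eq (phi := (map_poly E \o @biexpand K))
    (psi := line idfun (fun=> 0) (edge_coords 1 t))) => [c|i] /=.
    rewrite lineC /biexpand mmapC /= map_polyC /= /horner_eval !hornerC //.
  rewrite lineX biexpand_variable /biexpand_var /edge_coords.
  case: i => -[|[|[|//]]] hi /=.
  - by rewrite map_polyC /= /horner_eval hornerX horner0 mul0r addr0 polyC0.
  - by rewrite map_polyX add0r mul1r.
  - rewrite rmorphM /= map_polyX map_polyC /= /horner_eval hornerC hornerX.
    by rewrite add0r.
by rewrite coef_map (coef_biexpand_edge f0) /= /horner_eval hornerC.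
Qed.

Lemma coef_edge_poly_top : gamma`_d = top_value idfun (edge_coords 0 1) d f.
Proof.
have szf : msize f = d.+1 by rewrite prednK // lt0n msize_poly_eq0.
rewrite coef_poly ltn_predL szf /= subnn.
transitivity ((\sum_(m <- msupp f) f@_m *: 'X_[m])@_(mnm3 0 0 d)).
  by rewrite -mpolyE.
rewrite raddf_sum /top_value [RHS]big_mkcond /=; apply: eq_bigr => m _.
rewrite mcoeffZ mcoeffX mnm3P mdeg3 3!big_ord_recl big_ord0.
have -> : lift ord0 (lift ord0 ord0) = 2%:R :> 'I_3 by apply: val_inj.
have -> : lift ord0 ord0 = 1%R :> 'I_3 by apply: val_inj.
have -> : ord0 = 0%R :> 'I_3 by apply: val_inj.
rewrite /edge_coords /= !expr0n expr1n !mulr1.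
have [-> /=|_] := eqVneq (m 0%R) 0%N; last by rewrite mul0r mulr0 if_same.
have [-> /=|_] := eqVneq (m 1%R) 0%N; last by rewrite !mulr0 if_same.
by rewrite !mul1r !add0n; case: eqP; rewrite ?mulr0.
Qed.

Hypothesis f_deg : d = 2%N \/ d = 3%N.
Hypothesis anisotropic : forall a : 'I_3 -> K,
  (exists i, a i != 0) -> top_value idfun a d f != 0.

Lemma size_edge_poly : size gamma = d.+1.
Proof.
have szf : msize f = d.+1 by rewrite prednK // lt0n msize_poly_eq0.
apply/eqP; rewrite eqn_leq; apply/andP; split.
  by rewrite -szf; apply: size_poly.
apply: coef_neq0_size; rewrite coef_edge_poly_top; apply: anisotropic.
by exists 2%:R; rewrite /edge_coords /= oner_neq0.
Qed.

(** A reducible polynomial of degree two or three over a field has a root, and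
    a root [t] would give the zero [(0, 1, t)] of the top form; the remaining
    direction [(0, 0, 1)] ensures that [gamma] has degree exactly [d]. *)
Lemma irreducible_edge_poly : irreducible_poly gamma.
Proof.
apply: cubic_irreducible; first by rewrite size_edge_poly; case: f_deg => ->.
move=> t; rewrite /root horner_edge_poly; apply: anisotropic.
by exists 1%R; rewrite /edge_coords /= oner_neq0.
Qed.

End Edge.

Local Close Scope ring_scope.

Theorem proposition6p1 (K : fieldType) (L : closedFieldType)
    (iota : {rmorphism K -> L})
    (L_closure : is_algebraic_closure iota)
    (K_infinite : infinite_set [set: K]%classic)
    (f : {mpoly K[3]})
    (f_deg : (msize f).-1 = 2 \/ (msize f).-1 = 3)
    (f_prime : principal_is_prime f) :
  irreducible_set iota (at_infinity iota (affine_locus iota f)) ->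
  (exists2 P, at_infinity iota (affine_locus iota f) P &
              nonsingular_point iota f_prime P) ->
  (forall P, at_infinity iota (affine_locus iota f) P ->
             ~ K_rational iota P) ->
  has_krull_dim (recip_compl (coord_ring f_prime)) 2.
Proof.
move=> _ _ noK.
have f0 : (f != 0)%R by apply: contraPneq f_deg => ->; rewrite msize0; case.
have aniso := top_form_anisotropic K_infinite f0 f_prime noK.
have surj := @residue_surj K 3 f f_prime.
have ker := @residue_eq0 K 3 f f_prime.
split.
  exact: (surface_chain f0 (size_edge_poly f0 aniso)
    (irreducible_edge_poly f0 f_deg aniso) surj ker).
apply: prime_chain_le2 => y1 y2 y3.
apply: (recip_compl_relation f0 surj).
by apply/ker; exists 1%R; rewrite mul1r.
Qed.
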